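(* Let $a,b\ge2$ be integers, let $\nu\vdash b$ and $\mu\vdash ab$, and let $\mu'=\mu+(1^b)$. The multiplicity of $S^{\mu'}$ in $F_{\nu^\perp}^{a+1}$ is the same as the multiplicity of $S^\mu$ in $F_\nu^a$.
   Context: All modules are over $\mathbb{C}$. $S^\mu$ is the Specht module of $S_m$ for $\mu\vdash m$. $\nu^\perp$ denotes the conjugate partition of $\nu$. $\mu+(1^b)$ is the componentwise sum of partitions (padded by zeros), a partition of $(a+1)b$. $S_a\wr S_b\le S_{ab}$ is the stabilizer of a partition of $\{1,\dots,ab\}$ into $b$ blocks of size $a$; its base group $S_a^b$ has quotient $S_b$, and $\mathrm{Inf}_{S_b}^{S_a\wr S_b}S^\nu$ is $S^\nu$ viewed as an $S_a\wr S_b$-module via this quotient. The generalized Foulkes module is the $S_{ab}$-module $F_\nu^a=\mathrm{Inf}_{S_b}^{S_a\wr S_b}S^\nu\uparrow^{S_{ab}}$ (induced module). *)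

(* Defs.v *)
From HB Require Import structures.
From mathcomp Require Import all_boot all_order all_algebra all_fingroup.
From mathcomp Require Import all_solvable all_field all_character.
From mathcomp Require Import boolp reals complex.

Set Implicit Arguments.
Unset Strict Implicit.
Unset Printing Implicit Defensive.

Import GroupScope GRing.Theory.
Local Open Scope ring_scope.

Section Partitions.

Definition is_partn (n : nat) (mu : seq nat) : bool :=
  [&& sorted geq mu, 0%N \notin mu & sumn mu == n].

Definition conj_partn (mu : seq nat) : seq nat :=
  mkseq (fun j => count (fun p => j < p)%N mu) (head 0%N mu).

Definition add_partn (mu nu : seq nat) : seq nat :=
  mkseq (fun i => nth 0 mu i + nth 0 nu i)%N (maxn (size mu) (size nu)).

End Partitions.

Section PermutationModule.

Variables (F : fieldType) (gT : finGroupType) (T : finType).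
Variable to : {action gT &-> T}.

Definition basis_vec (x : T) : 'rV[F]_#|T| := delta_mx 0 (enum_rank x).

Definition perm_module_mx (g : gT) : 'M[F]_#|T| :=
  \matrix_i basis_vec (to (enum_val i) g).

Lemma basis_vec_act x g : basis_vec x *m perm_module_mx g = basis_vec (to x g).
Proof. by rewrite -rowE rowK enum_rankK. Qed.

Lemma perm_module_mx_repr : mx_repr [set: gT] perm_module_mx.
Proof.
split=> [|g h _ _]; apply/row_matrixP=> i; rewrite rowK.
  by rewrite act1 rowE mulmx1 /basis_vec enum_valK.
by rewrite row_mul rowK basis_vec_act actM.
Qed.

Definition perm_module := MxRepresentation perm_module_mx_repr.

End PermutationModule.

(* The boxes of the Young diagram of mu |- m are numbered 0, ..., m-1 row by  *)
(* row, so that box k lies in row reshape_index mu k and in column            *)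
(* reshape_offset mu k. A tableau of shape mu is a permutation t : 'S_m, with *)
(* t k the entry in box k. Permutations compose from left to right, S_m acts  *)
(* on the right, and t * g is the tableau obtained by applying g to each      *)
(* entry of t.                                                                *)
Section Specht.

Variables (F : fieldType) (m : nat) (mu : seq nat).
Implicit Types t g : 'S_m.

Definition row_of t (x : 'I_m) : nat := reshape_index mu (t^-1%g x).
Definition col_of t (x : 'I_m) : nat := reshape_offset mu (t^-1%g x).

Definition tabloid t : {set 'S_m} :=
  [set u : 'S_m | [forall x, row_of u x == row_of t x]].

Definition col_stab t : {set 'S_m} :=
  [set p : 'S_m | [forall x, col_of t (p x) == col_of t x]].

(* S_m permutes the tabloids by right translation, {t} * g = {t * g}; the     *)
(* ambient permutation module has all subsets of S_m as a basis, and the      *)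
(* Specht module only involves the basis vectors indexed by tabloids.         *)
Definition tabloid_module := perm_module F ('Rs : {action 'S_m &-> {set 'S_m}}).

Definition polytabloid t : 'rV[F]_#|{set 'S_m}| :=
  \sum_(p in col_stab t) (-1) ^+ odd_perm p *: basis_vec F (tabloid (t * p)%g).

Definition specht_mx : 'M[F]_#|{set 'S_m}| :=
  (\sum_(t : 'S_m) <<polytabloid t>>)%MS.

Lemma tabloid_act t g : tabloid t :* g = tabloid (t * g)%g.
Proof.
apply/setP=> u; rewrite mem_rcoset !inE.
have rowM v x : row_of (v * g)%g x = row_of v (g^-1%g x).
  by rewrite /row_of invMg permM.
apply/forallP/forallP=> eq_row x.
  by rewrite -[u](mulgKV g) !rowM eq_row.
by have := eq_row (g x); rewrite -{1}[u](mulgKV g) !rowM permK.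
Qed.

Lemma polytabloid_act t g :
  polytabloid t *m tabloid_module g = polytabloid (t * g)%g.
Proof.
rewrite /polytabloid mulmx_suml [RHS](reindex_inj (conjg_inj g)) /=.
apply: eq_big => [p | p _].
  rewrite !inE.
  have colM x : col_of (t * g)%g (g x) = col_of t x.
    by rewrite /col_of invMg permM permK.
  have colJ x : col_of (t * g)%g ((p ^ g)%g (g x)) = col_of t (p x).
    by rewrite -permM -conjgC permM colM.
  apply/forallP/forallP=> eq_col x.
    by rewrite -(permKV g x) colJ colM eq_col.
  by rewrite -colJ -(colM x) eq_col.
rewrite -scalemxAl basis_vec_act /= odd_permJ.
congr (_ *: basis_vec F _).
by rewrite -mulgA -conjgC mulgA rcosetE !tabloid_act.
Qed.

Lemma specht_mx_module : mxmodule tabloid_module specht_mx.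
Proof.
apply/mxmoduleP=> g _; rewrite sumsmxMr_gen; apply/sumsmx_subP=> t _.
rewrite genmxE (eqmxMr _ (genmxE _)) polytabloid_act.
by rewrite (sumsmx_sup (t * g)%g) // genmxE.
Qed.

Definition specht := submod_repr specht_mx_module.

End Specht.

(* The FG-module V (x)_{FH} FG = (+)_k V (x) k for an FH-module V, where k    *)
(* runs over representatives of the cosets H :* k of H in G:                  *)
(* (v (x) k_i) g = v (k_i g k_j^-1) (x) k_j when k_i g \in H :* k_j.          *)
Section Induction.

Variables (F : fieldType) (gT : finGroupType) (H G : {group gT}).
Hypothesis sHG : H \subset G.
Variables (n : nat) (rH : mx_representation F H n).

Definition coset_rep (i : 'I_#|G : H|) : gT := repr (enum_val i).

Definition induced_block (g : gT) (i j : 'I_#|G : H|) : 'M[F]_n :=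
  let h := (coset_rep i * g * (coset_rep j)^-1)%g in
  if h \in H then rH h else 0.

Definition induced_mx (g : gT) : 'M[F]_(\sum_(i < #|G : H|) n) :=
  \mxblock_(i, j) induced_block g i j.

Lemma coset_repP i : coset_rep i \in G /\ H :* coset_rep i = enum_val i.
Proof.
have /rcosetsP[x Gx def_i] := enum_valP i.
have Hrx : coset_rep i \in H :* x.
  by rewrite /coset_rep def_i; apply: mem_repr_rcoset.
split; last by rewrite def_i; apply/rcoset_eqP.
have /rcosetP[h Hh ->] := Hrx; exact: groupM (subsetP sHG _ Hh) Gx.
Qed.

Lemma coset_rep_of x : x \in G ->
  {j | forall i, (x * (coset_rep i)^-1 \in H)%g = (i == j)}.
Proof.
move=> Gx; have HxG : H :* x \in rcosets H G by apply/rcosetsP; exists x.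
exists (enum_rank_in HxG (H :* x)) => i.
rewrite -mem_rcoset -(inj_eq enum_val_inj) enum_rankK_in //.
have [_ <-] := coset_repP i.
by apply/idP/eqP=> [/rcoset_eqP-> | ->] //; apply: rcoset_refl.
Qed.

Lemma induced_mx_repr : mx_repr G induced_mx.
Proof.
split=> [|g h Gg Gh]; rewrite /induced_mx.
  rewrite -(mxdiagZ (p_ := fun=> n)); apply/eq_mxblock => i j.
  rewrite /induced_block mulg1; have [Gi _] := coset_repP i.
  have [k Hk] := coset_rep_of Gi.
  have eq_ik : i = k by apply/eqP; rewrite -Hk mulgV group1.
  rewrite Hk -eq_ik eq_sym; case: eqP => // <-.
  by rewrite mulgV repr_mx1 conform_mx_id.
rewrite mul_mxblock; apply/eq_mxblock => i k; rewrite /induced_block.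
have [[Gi _] [Gk _]] := (coset_repP i, coset_repP k).
have [j Hj] := coset_rep_of (groupM Gi Gg).
have Hij : (coset_rep i * g * (coset_rep j)^-1)%g \in H by rewrite Hj.
rewrite (bigD1 j) //= Hij big1 => [|l ne_lj]; last first.
  by rewrite Hj (negPf ne_lj) mul0mx.
rewrite addr0 /=.
have -> : (coset_rep i * (g * h) * (coset_rep k)^-1 =
  coset_rep i * g * (coset_rep j)^-1 * (coset_rep j * h * (coset_rep k)^-1))%g.
  by rewrite !mulgA mulgKV.
rewrite groupMl //; case: ifP => [Hjk|_]; last by rewrite mulmx0.
by rewrite repr_mxM.
Qed.

Definition induced_repr := MxRepresentation induced_mx_repr.

End Induction.

Section Foulkes.

Variables a b : nat.

Definition block (i : 'I_b) : {set 'I_(a * b)} :=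
  [set x : 'I_(a * b) | (x %/ a == i)%N].

Definition blocks : {set {set 'I_(a * b)}} := [set block i | i : 'I_b].

(* S_a wr S_b: the permutations of the points sending blocks to blocks.       *)
Definition wreath : {group 'S_(a * b)} := 'N(blocks | ('P)^*)%G.

(* The permutation of the b blocks induced by g; when a = 0 all blocks are    *)
(* empty and the conventional value is 1.                                     *)
Definition block_perm (g : 'S_(a * b)) : 'S_b :=
  odflt 1%g
    [pick s : 'S_b | (0 < a)%N && [forall i, g @: block i == block (s i)]].

Lemma block_neq0 i : (0 < a)%N -> block i != set0.
Proof.
move=> a_gt0; have lt_ia : (a * i < a * b)%N by rewrite ltn_pmul2l.
by apply/set0Pn; exists (Ordinal lt_ia); rewrite inE /= mulKn.
Qed.

Lemma block_inj : (0 < a)%N -> injective block.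
Proof.
move=> a_gt0 i j eq_ij; have /set0Pn[x Bx] := block_neq0 i a_gt0.
have Bjx : x \in block j by rewrite -eq_ij.
by apply/val_inj; move: Bx Bjx; rewrite !inE /= => /eqP <- /eqP.
Qed.

Lemma block_permP g i : (0 < a)%N -> g \in wreath ->
  g @: block i = block (block_perm g i).
Proof.
move=> a_gt0 Ng; rewrite /block_perm; case: pickP => [s /andP[_]|no_s].
  by move/forallP/(_ i)/eqP.
have Bg j : exists k, g @: block j == block k.
  have: g @: block j \in blocks.
    have Bj : block j \in blocks by apply: imset_f.
    by have := astabs_act (block j) Ng; rewrite Bj.
  by case/imsetP=> k _ ->; exists k.
pose f j := xchoose (Bg j).
have fP j : g @: block j = block (f j) by apply/eqP; apply: (xchooseP (Bg j)).
have f_inj : injective f.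
  move=> j k eq_f; apply: (block_inj a_gt0); apply: (imset_inj (@perm_inj _ g)).
  by rewrite !fP eq_f.
have := no_s (perm f_inj); rewrite a_gt0 /=.
by case/forallP=> j; rewrite permE fP.
Qed.

Lemma block_perm0 g : a = 0%N -> block_perm g = 1%g.
Proof. by rewrite /block_perm; case: pickP => // s /andP[/lt0n_neq0/eqP]. Qed.

Lemma block_permM : {in wreath &, {morph block_perm : g h / (g * h)%g}}.
Proof.
move=> g h Ng Nh; have [a0 | a_gt0] := posnP a.
  by rewrite !block_perm0 ?mulg1.
apply/permP=> i; apply: (block_inj a_gt0).
rewrite permM -!block_permP ?groupM //.
by rewrite -imset_comp; apply: eq_imset => x; rewrite /= permM.
Qed.

Canonical block_perm_morphism := Morphism block_permM.

Lemma wreath_sub_preim : wreath \subset block_perm @*^-1 [set: 'S_b].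
Proof. by rewrite morphpreT. Qed.

Variables (F : fieldType) (nu : seq nat).

Definition inflated_specht : mx_representation F wreath _ :=
  subg_repr (morphpre_repr block_perm_morphism (specht F b nu))
            wreath_sub_preim.

Definition foulkes : mx_representation F [set: 'S_(a * b)] _ :=
  induced_repr (subsetT wreath) inflated_specht.

End Foulkes.

(* The number of summands isomorphic to V in a decomposition of M into        *)
(* irreducibles: socle_mult W counts those in the homogeneous component W     *)
(* of M, whose irreducible summands are all isomorphic to socle_repr W.       *)
Definition multiplicity (F : closedFieldType) (gT : finGroupType)
    (G : {group gT}) (n1 n2 : nat) (V : mx_representation F G n1)
    (M : mx_representation F G n2) : nat :=
  (\sum_(W : DecSocleType M | `[< mx_rsim V (socle_repr W) >]) socle_mult W)%N.

(* Main.v *)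
(* Over a field of characteristic 0, the multiplicity of S^mu in a module M   *)
(* is the rank of the Young symmetrizer R C of mu acting on M. The Foulkes    *)
(* module embeds into the permutation module of fillings T of the diagram of  *)
(* mu with letters 0, ..., b-1, each used a times, and its image is generated *)
(* by the Young symmetrizer of nu permuting letters; so the multiplicity is   *)
(* the rank of the commuting Young symmetrizers of nu (on letters) and mu     *)
(* (on places). Sending T to the monomial prod_x X_(row x, T x) turns T.C     *)
(* into the product over the columns of the diagram of minors of the generic  *)
(* matrix X. Passing from mu to mu + (1^b) adds a column of length b, whose   *)
(* minor is 0 or +/- det X: this multiplies all polynomials by det X, and     *)
(* twists the action of S_b on letters by the sign, which amounts to          *)
(* conjugating nu. This is the isomorphism V^(mu + (1^b)) = V^mu (x) det of   *)
(* GL_b-modules, seen on weight spaces.                                       *)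

Require Import Defs.
From HB Require Import structures.
From mathcomp Require Import all_boot all_order all_algebra all_fingroup.
From mathcomp Require Import all_solvable all_character.
From mathcomp Require Import boolp reals complex mpoly.

Set Implicit Arguments.
Unset Strict Implicit.
Unset Printing Implicit Defensive.

Import GroupScope Order.TTheory GRing.Theory Num.Theory.
Local Open Scope ring_scope.

Section Symmetrizers.

Variables (F : fieldType) (m : nat).
Implicit Types (f : 'I_m -> nat) (g h : 'S_m) (e : bool).

Definition fiber_stab f : {set 'S_m} :=
  [set g : 'S_m | [forall x, f (g x) == f x]].

Lemma fiber_stabP f g : reflect (forall x, f (g x) = f x) (g \in fiber_stab f).
Proof. by rewrite inE; apply/(iffP forallP)=> H x; apply/eqP. Qed.

Lemma fiber_stab_group_set f : group_set (fiber_stab f).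
Proof.
apply/group_setP; split=> [|g h]; first by apply/fiber_stabP=> x; rewrite perm1.
by move=> /fiber_stabP Hg /fiber_stabP Hh; apply/fiber_stabP=> x; rewrite permM Hh.
Qed.
Canonical fiber_stab_group f := Group (fiber_stab_group_set f).

Definition sgn e g : F := (-1) ^+ (e && odd_perm g).

Lemma sgnM e g h : sgn e (g * h)%g = sgn e g * sgn e h.
Proof. by case: e; rewrite /sgn /= ?mulr1 // odd_permM signr_addb. Qed.

Lemma sgnV e g : sgn e g^-1 = sgn e g.
Proof. by rewrite /sgn odd_permV. Qed.

Lemma sgn_sq e g : sgn e g * sgn e g = 1.
Proof. by rewrite /sgn; case: (_ && _); rewrite ?mulr1 // mulrNN mulr1. Qed.

Lemma sgnN e g : sgn (~~ e) g = sgn true g * sgn e g.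
Proof. by case: e; rewrite ?sgn_sq // /sgn mulr1. Qed.

End Symmetrizers.

(* The symmetrizer (e = false) or antisymmetrizer (e = true) of the Young     *)
(* subgroup preserving the fibers of f.                                       *)
HB.lock Definition fsum (F : fieldType) m n
    (rG : mx_representation F [set: 'S_m] n) (e : bool) (f : 'I_m -> nat) :=
  \sum_(g in fiber_stab f) sgn F e g *: rG g.

Section SymmetrizerTheory.

Variables (F : fieldType) (m : nat).
Implicit Types (f : 'I_m -> nat) (g h : 'S_m) (e : bool).

Section Representation.

Variables (n : nat) (rG : mx_representation F [set: 'S_m] n).

Lemma reprM g h : rG (g * h)%g = rG g *m rG h.
Proof. by rewrite repr_mxM ?inE. Qed.

Lemma fsumMl e f h : h \in fiber_stab f -> rG h *m fsum rG e f = sgn F e h *: fsum rG e f.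
Proof.
move=> Sh; rewrite fsum.unlock mulmx_sumr scaler_sumr.
rewrite [RHS](reindex_inj (mulgI h)) /=; apply: eq_big => [g | g _].
  by rewrite groupMl.
by rewrite -scalemxAr -reprM sgnM scalerA mulrA sgn_sq mul1r.
Qed.

Lemma fsumMr e f h : h \in fiber_stab f -> fsum rG e f *m rG h = sgn F e h *: fsum rG e f.
Proof.
move=> Sh; rewrite fsum.unlock mulmx_suml scaler_sumr.
rewrite [RHS](reindex_inj (mulIg h)) /=; apply: eq_big => [g | g _].
  by rewrite groupMr.
by rewrite -scalemxAl -reprM sgnM scalerA [sgn F e g * _]mulrC mulrA sgn_sq mul1r.
Qed.

Lemma fsumJ e f (z : 'S_m) :
  rG z^-1%g *m fsum rG e f *m rG z = fsum rG e (f \o z^-1%g).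
Proof.
rewrite fsum.unlock mulmx_sumr mulmx_suml [RHS](reindex_inj (conjg_inj z)) /=.
apply: eq_big => [g | g _].
  apply/fiber_stabP/fiber_stabP => /= H x.
    by rewrite conjgE !permM permK H.
  by have := H (z x); rewrite conjgE !permM !permK.
by rewrite -scalemxAr -scalemxAl -!reprM /sgn odd_permJ conjgE mulgA.
Qed.

End Representation.

Lemma fsum_hom e e' f n1 n2 (rG1 : mx_representation F [set: 'S_m] n1)
    (rG2 : mx_representation F [set: 'S_m] n2) (X : 'M_(n1, n2)) :
    (forall g, rG1 g *m X = sgn F e' g *: (X *m rG2 g)) ->
  fsum rG1 e f *m X = X *m fsum rG2 (e (+) e') f.
Proof.
move=> homX; rewrite !fsum.unlock mulmx_suml mulmx_sumr; apply: eq_bigr => g _.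
rewrite -scalemxAl homX scalerA -scalemxAr; congr (_ *: _).
case: e' {homX}; rewrite ?addbT ?addbF ?sgnN 1?mulrC //.
by rewrite /sgn /= mul1r.
Qed.

End SymmetrizerTheory.

Lemma mxtrace_quasi_idem (F : fieldType) n (A : 'M[F]_n) (l : F) :
  A *m A = l *: A -> \tr A = l * (\rank A)%:R.
Proof.
move=> AA; rewrite -{1}(mulmx_base A) mxtrace_mulC.
suffices ->: row_base A *m col_base A = l%:M by rewrite mxtrace_scalar mulr_natr.
apply: (row_free_inj (row_base_free A)); apply: (row_full_inj (col_base_full A)).
rewrite mulmxA mulmxA -mulmxA !mulmx_base AA.
by rewrite mul_scalar_mx -scalemxAr mulmx_base.
Qed.

(** * Young symmetrizers *)

Lemma leq_card_inj (T : finType) (A : {pred T}) (f : T -> nat) k :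
  {in A &, injective f} -> {in A, forall x, (f x < k)%N} -> (#|A| <= k)%N.
Proof.
move=> injf ltf; rewrite cardE -(size_map f) -(size_iota 0 k).
apply: uniq_leq_size => [|_ /mapP[x Ax ->]].
  by rewrite map_inj_in_uniq ?enum_uniq // => x y; rewrite !mem_enum; apply: injf.
by move: Ax; rewrite mem_enum mem_iota => /ltf.
Qed.

Section Diagrams.

Variable m : nat.
Implicit Types (rw cl : 'I_m -> nat) (g : 'S_m).

Definition diagram rw cl : Prop :=
  injective (fun x => (rw x, cl x)) /\
  forall x i j, (i <= rw x)%N -> (j <= cl x)%N -> exists y, rw y = i /\ cl y = j.

Lemma diagram_sym rw cl : diagram rw cl -> diagram cl rw.
Proof.
case=> inj_d down; split=> [x y [eq_c eq_r] | x i j le_i le_j];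
  first by apply: inj_d; rewrite eq_c eq_r.
by have [y []] := down x j i le_j le_i; exists y.
Qed.

Lemma diagram_perm rw cl g : diagram rw cl -> diagram (rw \o g) (cl \o g).
Proof.
case=> inj_d down; split=> [x y /inj_d/perm_inj// | x i j le_i le_j].
by have [y [<- <-]] := down _ _ _ le_i le_j; exists (g^-1 y)%g; rewrite /= permKV.
Qed.

(* Sorting each column of the tableau g^-1 by row index gives an element of   *)
(* the column group; the new row indices are at most the old ones and have    *)
(* the same sum, hence agree with them.                                       *)
Lemma row_col_factor rw cl g : diagram rw cl ->
    (forall x y, x != y -> cl x = cl y -> rw (g^-1 x)%g <> rw (g^-1 y)%g) ->
  exists2 r, r \in fiber_stab rw & exists2 p, p \in fiber_stab cl & g = (r * p)%g.
Proof.
move=> [inj_d down] sep; pose a x := rw (g^-1 x)%g.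
have inj_a x y : cl x = cl y -> a x = a y -> x = y.
  by move=> eq_c eq_a; apply/eqP/negPn/negP => /sep/(_ eq_c)[].
pose below x := [pred y | cl y == cl x & (a y < a x)%N].
have le_k x : (#|below x| <= a x)%N.
  apply: (leq_card_inj (f := a)) => [y z | y]; rewrite !inE.
    by case/andP=> /eqP cy _ /andP[/eqP cz _]; apply: inj_a; rewrite cy cz.
  by case/andP.
have box x : exists y, (cl y == cl x) && (rw y == #|below x|).
  apply: contrapT => no_box.
  have le_col : (#|[pred y | cl y == cl x]| <= #|below x|)%N.
    apply: (leq_card_inj (f := rw)) => [y z | y]; rewrite !inE.
      by move=> /eqP cy /eqP cz eq_r; apply: inj_d; rewrite eq_r cy cz.
    move=> /eqP cy; rewrite ltnNge; apply/negP => le_r.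
    have [z [rz cz]] := down y #|below x| (cl x) le_r (eq_leq (esym cy)).
    by case: no_box; exists z; rewrite cz rz !eqxx.
  have /proper_card : below x \proper [pred y | cl y == cl x].
    apply/properP; split; first by apply/subsetP=> y; rewrite !inE => /andP[].
    by exists x; rewrite !inE ?eqxx ?ltnn.
  by rewrite ltnNge le_col.
pose p0 x := xchoose (box x).
have p0P x : cl (p0 x) = cl x /\ rw (p0 x) = #|below x|.
  by have /andP[/eqP-> /eqP->] := xchooseP (box x).
have inj_p0 : injective p0.
  move=> x y eq_p; have [cx rx] := p0P x; have [cy ry] := p0P y.
  have eq_c : cl x = cl y by rewrite -cx -cy eq_p.
  have lt_below u v : cl u = cl v -> (a u < a v)%N -> (#|below u| < #|below v|)%N.
    move=> cuv lt_a; apply/proper_card/properP; split.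
      apply/subsetP=> w; rewrite !inE cuv => /andP[->] /=.
      by move/ltn_trans; apply.
    by exists u; rewrite !inE ?ltnn ?andbF // cuv eqxx.
  have eq_k : #|below x| = #|below y| by rewrite -rx -ry eq_p.
  apply: (inj_a _ _ eq_c); case: (ltngtP (a x) (a y)) => // lt_a.
    by have := lt_below _ _ eq_c lt_a; rewrite eq_k ltnn.
  by have := lt_below _ _ (esym eq_c) lt_a; rewrite eq_k ltnn.
pose p := perm inj_p0.
have rwp x : rw (p x) = a x.
  rewrite permE; have [_ ->] := p0P x.
  have eq_sum : (\sum_x #|below x| == \sum_x a x)%N.
    apply/eqP; transitivity (\sum_x rw x)%N; last first.
      by rewrite (reindex_inj (@perm_inj _ g^-1%g)).
    rewrite [RHS](reindex_inj (@perm_inj _ p)); apply: eq_bigr => y _.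
    by rewrite permE; have [_ ->] := p0P y.
  have /leqif_sum [_ ] :
    forall x, true -> (#|below x| <= a x ?= iff (#|below x| == a x))%N.
    by move=> y _; split.
  by rewrite eq_sum => /esym/forallP/(_ x)/eqP.
exists (g * p)%g; first by apply/fiber_stabP=> x; rewrite permM rwp /a permK.
exists p^-1%g; last by rewrite mulgK.
by rewrite groupV; apply/fiber_stabP=> x; rewrite permE; have [-> _] := p0P x.
Qed.

End Diagrams.

Lemma mxtrace_regular (F : fieldType) (gT : finGroupType) (g : gT) :
  \tr (perm_module F ('R : {action gT &-> gT}) g)
    = if g == 1%g then #|gT|%:R else 0.
Proof.
case: eqP => [-> | ne_g]; first by rewrite repr_mx1 mxtrace1.
apply: big1 => i _; rewrite mxE /basis_vec mxE /=.
case: eqP => // /(congr1 enum_val); rewrite enum_rankK => eq_i.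
by case: ne_g; apply: (mulgI (enum_val i)); rewrite mulg1.
Qed.

Section YoungSymmetrizer.

Variables (F : numFieldType) (m : nat) (rw cl : 'I_m -> nat).
Hypothesis D : diagram rw cl.

Notation rsym rG := (fsum rG false rw).
Notation calt rG := (fsum rG true cl).

Lemma young_scalar (g : 'S_m) : exists l : F,
  forall n (rG : mx_representation F [set: 'S_m] n),
    rsym rG *m rG g *m calt rG = l *: (rsym rG *m calt rG).
Proof.
have [[x [y [ne_xy eq_c eq_r]]] | sep] := pselect (exists x y,
    [/\ x != y, cl x = cl y & rw (g^-1 x)%g = rw (g^-1 y)%g]).
  exists 0 => n rG; rewrite scale0r; pose t := tperm x y.
  have Ct : t \in fiber_stab cl.
    by apply/fiber_stabP=> z; rewrite /t; case: tpermP => [->|->|].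
  have Rt : (t ^ g^-1)%g \in fiber_stab rw.
    rewrite tpermJ; apply/fiber_stabP=> z.
    by case: tpermP => [->|->|].
  have: rsym rG *m (rG (t ^ g^-1)%g *m rG g) *m calt rG
        = rsym rG *m (rG g *m rG t) *m calt rG.
    by rewrite -!reprM conjgE invgK !mulgA mulgKV.
  rewrite !mulmxA (fsumMr _ _ Rt) -!mulmxA (fsumMl _ _ Ct) -scalemxAl -!scalemxAr.
  rewrite /sgn /= expr0 scale1r odd_tperm ne_xy expr1 scaleN1r => /eqP.
  by rewrite -addr_eq0 -mulr2n -scaler_nat scaler_eq0 pnatr_eq0 => /eqP.
have [|r Rr [p Cp ->]] := row_col_factor (g := g) D.
  by move=> x y ne_xy eq_c eq_r; apply: sep; exists x, y.
exists (sgn F true p) => n rG.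
by rewrite reprM mulmxA fsumMr // -scalemxAl scale1r -mulmxA fsumMl // -scalemxAr.
Qed.

Lemma young_sandwich (g : 'S_m) : exists l : F,
  forall n (rG : mx_representation F [set: 'S_m] n),
    rsym rG *m calt rG *m rG g *m (rsym rG *m calt rG)
      = l *: (rsym rG *m calt rG).
Proof.
have /fin_all_exists[eps epsP] := young_scalar.
exists (\sum_(p in fiber_stab cl) \sum_(r in fiber_stab rw)
  sgn F true p * eps (p * g * r)%g) => n rG.
have CR : calt rG *m rG g *m rsym rG = \sum_(p in fiber_stab cl)
    \sum_(r in fiber_stab rw) sgn F true p *: rG (p * g * r)%g.
  rewrite !fsum.unlock !mulmx_suml; apply: eq_bigr => p _.
  rewrite mulmx_sumr; apply: eq_bigr => r _.
  by rewrite {2}/sgn /= expr0 scale1r -!scalemxAl !reprM.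
rewrite -[rsym rG *m _ *m _]mulmxA mulmxA -[rsym rG *m _ *m _]mulmxA CR.
rewrite mulmx_sumr mulmx_suml scaler_suml; apply: eq_bigr => p _.
rewrite mulmx_sumr mulmx_suml scaler_suml; apply: eq_bigr => r _.
by rewrite -scalemxAr -scalemxAl epsP scalerA.
Qed.

Lemma row_col_stab1 (g : 'S_m) :
  g \in fiber_stab rw -> g \in fiber_stab cl -> g = 1%g.
Proof.
move=> /fiber_stabP Rg /fiber_stabP Cg; have [inj_d _] := D.
by apply/permP=> x; rewrite perm1; apply: inj_d; rewrite Rg Cg.
Qed.

Lemma young_quasi_idem : exists2 l : F, l != 0 &
  forall n (rG : mx_representation F [set: 'S_m] n),
    rsym rG *m calt rG *m (rsym rG *m calt rG) = l *: (rsym rG *m calt rG).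
Proof.
have [l lP] := young_sandwich 1%g.
have idem n (rG : mx_representation F [set: 'S_m] n) :
    rsym rG *m calt rG *m (rsym rG *m calt rG) = l *: (rsym rG *m calt rG).
  by rewrite -lP repr_mx1 mulmx1.
exists l => //.
have trR := @mxtrace_regular F {perm 'I_m}.
move: (perm_module _ _) trR => rG trR.
have RC1 r p : r \in fiber_stab rw -> p \in fiber_stab cl ->
    (r * p == 1)%g = (r == 1%g) && (p == 1%g).
  move=> Rr Cp; apply/eqP/andP=> [rp1 | [/eqP-> /eqP->]]; last by rewrite mulg1.
  have p_r : p = r^-1%g by rewrite -[p](mulKg r) rp1 mulg1.
  suffices r1 : r = 1%g by rewrite p_r r1 invg1.
  by apply: row_col_stab1; rewrite // -groupV -p_r.
have: \tr (rsym rG *m calt rG) = #|{perm 'I_m}|%:R.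
  rewrite !fsum.unlock mulmx_suml raddf_sum (bigD1 1%g) //= [X in _ + X]big1 ?addr0.
    rewrite mulmx_sumr raddf_sum (bigD1 1%g) //= [X in _ + X]big1 ?addr0.
      by rewrite /sgn odd_perm1 !scale1r -reprM mulg1 trR eqxx.
    move=> p /andP[Cp /negPf p1].
    rewrite /= -scalemxAr -scalemxAl -reprM !mxtraceZ trR RC1 ?group1 //.
    by rewrite p1 andbF !mulr0.
  move=> r /andP[Rr /negPf r1]; rewrite mulmx_sumr raddf_sum big1 // => p Cp.
  rewrite /= -scalemxAr -scalemxAl -reprM !mxtraceZ trR RC1 //.
  by rewrite r1 !mulr0.
rewrite (mxtrace_quasi_idem (idem _ rG)); apply: contra_eq_neq => ->.
by rewrite mul0r eq_sym pnatr_eq0 -lt0n; apply/card_gt0P; exists 1%g.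
Qed.

End YoungSymmetrizer.

(** * Multiplicities of Specht modules *)

Section Representations.

Variables (F : fieldType) (gT : finGroupType) (G : {group gT}).

Lemma hom_irr_rsim n1 n2 (rG1 : mx_representation F G n1)
    (rG2 : mx_representation F G n2) (Y : 'M_(n1, n2)) :
    mx_irreducible rG1 -> mx_irreducible rG2 -> Y != 0 ->
    {in G, forall g, rG1 g *m Y = Y *m rG2 g} ->
  mx_rsim rG1 rG2.
Proof.
move=> /mx_irrP[_ irr1] /mx_irrP[_ irr2] nzY homY.
have freeY : row_free Y.
  rewrite -kermx_eq0; apply: contraNT nzY => /irr1/= fullK.
  rewrite -[Y]mul1mx -sub_kermx sub1mx fullK //.
  apply/mxmoduleP=> g Gg; apply/sub_kermxP.
  by rewrite -mulmxA homY // mulmxA mulmx_ker mul0mx.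
have fullY : row_full Y.
  rewrite -sub1mx -(genmxE Y) sub1mx; apply: irr2.
    apply/mxmoduleP=> g Gg; rewrite genmxE (eqmxMr _ (genmxE _)).
    by rewrite -homY // submxMl.
  by rewrite -submx0 genmxE submx0.
exists Y => //; by rewrite -(eqP freeY) (eqP fullY).
Qed.

Lemma submod_hom n (rG : mx_representation F G n) (U : 'M_n)
    (modU : mxmodule rG U) g : g \in G ->
  submod_repr modU g *m val_submod (1%:M : 'M_(\rank U))
    = val_submod (1%:M : 'M_(\rank U)) *m rG g.
Proof. by move=> Gg; rewrite -val_submodJ // mul1mx -val_submodE. Qed.

End Representations.

Lemma rank_fsum_rsim (F : fieldType) m n1 n2
    (rG1 : mx_representation F [set: 'S_m] n1)
    (rG2 : mx_representation F [set: 'S_m] n2) e1 f1 e2 f2 :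
    mx_rsim rG1 rG2 ->
  \rank (fsum rG1 e1 f1 *m fsum rG1 e2 f2)
    = \rank (fsum rG2 e1 f1 *m fsum rG2 e2 f2).
Proof.
case=> B eq_n freeB homB.
have hom' g : rG1 g *m B = sgn F false g *: (B *m rG2 g).
  by rewrite /sgn scale1r homB ?inE.
have fullB : row_full B by rewrite /row_full (eqP freeB) eq_n.
rewrite -(mxrankMfree _ freeB) -mulmxA !(fsum_hom _ _ hom', addbF) mulmxA.
rewrite (fsum_hom _ _ hom') addbF -mulmxA.
by rewrite (eqmxMfull _ fullB).
Qed.

Section Specht.

Variables (F : numFieldType) (m : nat) (mu : seq nat).

Definition box_row (x : 'I_m) := reshape_index mu x.
Definition box_col (x : 'I_m) := reshape_offset mu x.

Hypothesis D : diagram box_row box_col.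

Notation P := (tabloid_module F m).
Notation S := (specht F m mu).
Notation e := (polytabloid F mu 1%g : 'rV_#|{set 'S_m}|).
Notation t0 := (basis_vec F (tabloid mu 1%g) : 'rV_#|{set 'S_m}|).
Notation rsym rG := (fsum rG false box_row).
Notation calt rG := (fsum rG true box_col).

Lemma tabloid1 : tabloid mu 1%g = fiber_stab box_row.
Proof.
apply/setP=> u; rewrite -groupV !inE; apply: eq_forallb => x.
by rewrite /row_of invg1 perm1.
Qed.

Lemma col_stab1 : col_stab mu 1%g = fiber_stab box_col.
Proof.
apply/setP=> u; rewrite !inE; apply: eq_forallb => x.
by rewrite /col_of invg1 !perm1.
Qed.

Lemma polytabloidE t : polytabloid F mu t = t0 *m calt P *m P t.
Proof.
rewrite -{1}[t]mul1g -polytabloid_act; congr (_ *m _).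
rewrite fsum.unlock /polytabloid col_stab1 mulmx_sumr; apply: eq_bigr => p _.
rewrite -scalemxAr basis_vec_act /= rcosetE tabloid_act; congr (_ *: _).
Qed.

Lemma tabloid_rsym : t0 *m rsym P = #|fiber_stab box_row|%:R *: t0.
Proof.
rewrite fsum.unlock mulmx_sumr scaler_nat -sumr_const; apply: eq_bigr => r Rr.
rewrite scale1r basis_vec_act /= rcosetE tabloid1.
by congr basis_vec; apply: rcoset_id.
Qed.

Lemma rsym_card_neq0 : #|fiber_stab box_row|%:R != 0 :> F.
Proof. by rewrite pnatr_eq0 -lt0n cardG_gt0. Qed.

Lemma polytabloid_rsym :
  t0 *m (rsym P *m calt P) = #|fiber_stab box_row|%:R *: e.
Proof. by rewrite mulmxA tabloid_rsym -scalemxAl polytabloidE repr_mx1 mulmx1. Qed.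

Lemma polytabloid_young t :
  exists l : F, polytabloid F mu t *m (rsym P *m calt P) = l *: e.
Proof.
have [l lP] := young_sandwich F D t; exists l.
apply: (scalerI rsym_card_neq0); rewrite polytabloidE !scalemxAl -tabloid_rsym.
rewrite scalerA mulrC -scalerA -polytabloid_rsym -[t0 *m _ *m calt P]mulmxA.
by rewrite -2!mulmxA [rsym P *m _ *m _]mulmxA lP -scalemxAr.
Qed.

Lemma polytabloid_young1 :
  exists2 l : F, l != 0 & e *m (rsym P *m calt P) = l *: e.
Proof.
have [l nz_l lP] := young_quasi_idem F D; exists l => //.
apply: (scalerI rsym_card_neq0); rewrite scalemxAl -polytabloid_rsym -mulmxA lP.
by rewrite -scalemxAr polytabloid_rsym !scalerA mulrC.
Qed.

Lemma polytabloid_neq0 : e != 0.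
Proof.
apply/eqP=> /(congr1 (fun v : 'rV_#|{set 'S_m}| => v 0 (enum_rank (tabloid mu 1%g)))).
rewrite /polytabloid summxE mxE (bigD1 1%g) ?col_stab1 ?group1 //= big1.
  by rewrite addr0 mulg1 !mxE !eqxx odd_perm1 mulr1 => /eqP; rewrite oner_eq0.
move=> p /andP[Cp ne_p]; rewrite mul1g !mxE eqxx /= (inj_eq enum_rank_inj).
case: eqP => [eq_t|]; last by rewrite mulr0.
case/eqP: ne_p; apply: (row_col_stab1 D _ Cp).
rewrite -tabloid1 eq_t -[p]mul1g -tabloid_act tabloid1 mul1g.
exact: rcoset_refl.
Qed.

Lemma specht_mxP n (W : 'M_(n, #|{set 'S_m}|)) :
  (forall t, (polytabloid F mu t <= W)%MS) -> (specht_mx F m mu <= W)%MS.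
Proof. by move=> sub; apply/sumsmx_subP=> t _; rewrite genmxE. Qed.

Lemma polytabloid_sub t : (polytabloid F mu t <= specht_mx F m mu)%MS.
Proof. by rewrite (sumsmx_sup t) // genmxE. Qed.

Lemma specht_young_sub : (specht_mx F m mu *m (rsym P *m calt P) <= e)%MS.
Proof.
rewrite sumsmxMr_gen; apply/sumsmx_subP=> t _.
rewrite genmxE (eqmxMr _ (genmxE _)).
by have [l ->] := polytabloid_young t; apply: scalemx_sub.
Qed.

Lemma polytabloid_gen (W : 'M_#|{set 'S_m}|) :
  mxmodule P W -> (e <= W)%MS -> (specht_mx F m mu <= W)%MS.
Proof.
move=> modW sub; apply: specht_mxP => t.
by rewrite -[t]mul1g -polytabloid_act mxmodule_trans ?inE.
Qed.

Lemma mxmodule_young (W : 'M_#|{set 'S_m}|) :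
  mxmodule P W -> (W *m (rsym P *m calt P) <= W)%MS.
Proof.
move=> /mxmoduleP modW.
have sub b f : (W *m fsum P b f <= W)%MS.
  rewrite fsum.unlock mulmx_sumr; apply: summx_sub => g _.
  by rewrite -scalemxAr scalemx_sub ?modW ?inE.
by rewrite mulmxA; apply: submx_trans (submxMr _ (sub _ _)) (sub _ _).
Qed.

Lemma specht_simple : mxsimple P (specht_mx F m mu).
Proof.
split; first exact: specht_mx_module.
  apply: contraNneq polytabloid_neq0 => S0.
  by have := polytabloid_sub 1%g; rewrite S0 submx0.
move=> W modW sWS nzW.
have sWe := submx_trans (submxMr _ sWS) specht_young_sub.
have [W0 | nzWc] := eqVneq (W *m (rsym P *m calt P)) 0; last first.
  apply: polytabloid_gen => //; apply: submx_trans (mxmodule_young modW).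
  rewrite -(geq_leqif (mxrank_leqif_sup sWe)).
  by apply: leq_trans (rank_leq_row _) _; rewrite lt0n mxrank_eq0.
have Fp : [pchar F]^'.-group [set: 'S_m].
  by rewrite /pgroup pcharf'_nat pnatr_eq0 -lt0n cardG_gt0.
have [W' modW' defP dxW] := mx_Maschke_pchar P Fp modW (submx1 W).
have [l nz_l lP] := polytabloid_young1.
have : (e <= W + W')%MS by rewrite defP submx1.
case/sub_addsmxP=> -[u u'] /= def_e.
have sW'e : (e <= W')%MS.
  rewrite -(eqmx_scale _ nz_l) -lP {1}def_e mulmxDl -mulmxA W0 mulmx0 add0r.
  by rewrite -mulmxA mulmx_sub // mxmodule_young.
case/eqP: nzW; apply/eqP; rewrite -submx0 -(mxdirect_addsP dxW) sub_capmx submx_refl.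
by rewrite (submx_trans sWS) // polytabloid_gen.
Qed.

Lemma specht_irr : mx_irreducible S.
Proof. exact/submod_mx_irr/specht_simple. Qed.

Lemma specht_hom b f :
  fsum S b f *m val_submod (1%:M : 'M_(\rank (specht_mx F m mu)))
    = val_submod (1%:M : 'M_(\rank (specht_mx F m mu))) *m fsum P b f.
Proof.
rewrite -[in RHS](addbF b); apply: fsum_hom => g.
by rewrite /sgn scale1r submod_hom ?inE.
Qed.

Lemma rank_young_specht : \rank (rsym S *m calt S) = 1%N.
Proof.
have freeX : row_free (val_submod (1%:M : 'M_(\rank (specht_mx F m mu)))).
  by rewrite /row_free val_submod1.
rewrite -(mxrankMfree _ freeX) -mulmxA specht_hom mulmxA specht_hom -mulmxA.
rewrite (eqmxMr _ (val_submod1 _)); apply/eqP; rewrite eqn_leq.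
rewrite (leq_trans (mxrankS specht_young_sub) (rank_leq_row _)) lt0n mxrank_eq0.
have [l nz_l lP] := polytabloid_young1.
apply: contraNneq polytabloid_neq0 => Sc0.
have := submxMr (rsym P *m calt P) (polytabloid_sub 1%g).
by rewrite Sc0 submx0 lP scaler_eq0 (negPf nz_l).
Qed.

Lemma rank_young_irr n (rG : mx_representation F [set: 'S_m] n) :
  mx_irreducible rG -> \rank (rsym rG *m calt rG) = `[< mx_rsim S rG >] :> nat.
Proof.
move=> irrG; case: asboolP => [/rank_fsum_rsim<- | not_sim].
  exact: rank_young_specht.
apply/eqP; rewrite mxrank_eq0; apply: contra_notT not_sim.
rewrite -submx0 => /row_subPn [i nz_i].
move: nz_i; rewrite submx0 rowE; move: (delta_mx 0 i) => w nz_w {i}.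
pose f : 'M_(#|{set 'S_m}|, n) :=
  \matrix_i (\sum_(g in (enum_val i : {set 'S_m})) w *m rG g).
have fE A : basis_vec F A *m f = \sum_(g in A) w *m rG g.
  by rewrite -rowE rowK enum_rankK.
have homf g : P g *m f = f *m rG g.
  apply/row_matrixP=> i; rewrite row_mul rowK fE row_mul rowK mulmx_suml.
  rewrite [LHS](reindex_inj (mulIg g)) /=; apply: eq_big => [h | h _].
    by rewrite rcosetE mem_rcoset mulgK.
  by rewrite reprM mulmxA.
have homf' b h : fsum P b h *m f = f *m fsum rG b h.
  rewrite -[in RHS](addbF b); apply: fsum_hom => g.
  by rewrite /sgn scale1r.
apply: (hom_irr_rsim (Y := val_submod 1%:M *m f)) => //.
- exact: specht_irr.
- apply: contraNneq nz_w => Xf0.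
  have : e *m f == 0.
    rewrite -(in_submodK (polytabloid_sub 1%g)) val_submodE -mulmxA.
    by rewrite Xf0 mulmx0.
  rewrite polytabloidE repr_mx1 mulmx1 -mulmxA homf' [t0 *m _]mulmxA fE tabloid1.
  rewrite -mulmx_sumr (_ : \sum_(g in _) _ = rsym rG) ?mulmxA => [-> // |].
  by rewrite fsum.unlock; apply: eq_bigr => g _; rewrite scale1r.
move=> g _; rewrite mulmxA submod_hom ?inE //.
by rewrite -!mulmxA homf.
Qed.

End Specht.

Lemma multiplicity_specht (F : numClosedFieldType) m mu n
    (M : mx_representation F [set: 'S_m] n) :
    diagram (@box_row m mu) (@box_col m mu) ->
  multiplicity (specht F m mu) M
    = \rank (fsum M false (@box_row m mu) *m fsum M true (@box_col m mu)).
Proof.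
move=> D; have [l nz_l lP] := young_quasi_idem F D.
pose c n' (rG : mx_representation F [set: 'S_m] n') :=
  fsum rG false (@box_row m mu) *m fsum rG true (@box_col m mu).
rewrite -/(c _ M).
have trc n' (rG : mx_representation F [set: 'S_m] n') :
    \tr (c _ rG) = l * (\rank (c _ rG))%:R.
  exact: (mxtrace_quasi_idem (lP _ rG)).
have trcE n' (rG : mx_representation F [set: 'S_m] n') : \tr (c _ rG) =
    \sum_(r in fiber_stab (@box_row m mu)) \sum_(p in fiber_stab (@box_col m mu))
       sgn F true p * \tr (rG (r * p)%g).
  rewrite /c !fsum.unlock mulmx_suml raddf_sum; apply: eq_bigr => r _.
  rewrite mulmx_sumr raddf_sum; apply: eq_bigr => p _ /=.
  by rewrite scale1r -scalemxAr mxtraceZ reprM.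
have Fp : [pchar F]^'.-group [set: 'S_m].
  by rewrite /pgroup pcharf'_nat pnatr_eq0 -lt0n cardG_gt0.
have soc1 : Socle (DecSocleType M) = 1%:M.
  exact/reducible_Socle1/mx_Maschke_pchar.
have trM g : \tr (M g)
    = \sum_(W : DecSocleType M) \tr (socle_repr W g) *+ socle_mult W.
  rewrite -mxtrace_Socle ?inE // (mxtrace_submod1 (Socle_module _)) ?inE //.
  by rewrite soc1.
apply/eqP; rewrite -(eqr_nat F) -(inj_eq (mulfI nz_l)) -trc trcE; apply/eqP.
under eq_bigr do under eq_bigr do rewrite trM mulr_sumr.
rewrite /multiplicity big_mkcond natr_sum mulr_sumr /=.
under [RHS]eq_bigr do rewrite exchange_big.
rewrite [RHS]exchange_big; apply: eq_bigr => W _ /=.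
transitivity (\tr (c _ (socle_repr W)) *+ socle_mult W).
  rewrite trc rank_young_irr //; last exact: socle_irr.
  by case: asboolP => _; rewrite ?mulr1 ?mulr0 ?mul0rn // mulr_natr.
rewrite trcE -sumrMnl; apply: eq_bigr => r _.
by rewrite -sumrMnl; apply: eq_bigr => p _; rewrite mulrnAr.
Qed.

(** * Conjugation and addition of a column *)

Section Boxes.

Variables (m : nat) (mu : seq nat).
Hypothesis sum_mu : sumn mu = m.

Lemma box_bound (x : 'I_m) : (box_col mu x < nth 0 mu (box_row mu x))%N.
Proof. by apply: reshape_offsetP; rewrite sum_mu. Qed.

Lemma box_exists i j : (j < nth 0 mu i)%N ->
  exists x : 'I_m, box_row mu x = i /\ box_col mu x = j.
Proof.
move=> lt_j; have lt_ij := flatten_indexP lt_j; rewrite sum_mu in lt_ij.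
exists (Ordinal lt_ij).
by split; [apply: flatten_indexKl | apply: flatten_indexKr].
Qed.

Lemma box_inj : injective (fun x : 'I_m => (box_row mu x, box_col mu x)).
Proof.
move=> x y [eq_r eq_c]; apply: val_inj => /=.
by rewrite -(reshape_indexK mu x) -(reshape_indexK mu y); congr flatten_index.
Qed.

Lemma box_diagram :
    (forall i j, (i <= j)%N -> (nth 0 mu j <= nth 0 mu i)%N) ->
  diagram (@box_row m mu) (@box_col m mu).
Proof.
move=> dec_mu; split; first exact: box_inj.
move=> x i j le_i le_j; apply: box_exists; apply: leq_ltn_trans le_j _.
exact: leq_trans (box_bound x) (dec_mu _ _ le_i).
Qed.

End Boxes.

Lemma partn_nth_geq n mu i j :
  is_partn n mu -> (i <= j)%N -> (nth 0 mu j <= nth 0 mu i)%N.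
Proof.
case/and3P=> srt _ _ le_ij; have [lt_j | le_j] := ltnP j (size mu); last first.
  by rewrite (nth_default _ le_j).
apply: (sorted_leq_nth _ _ 0 srt) => //.
- by move=> x y z le_xy le_zx; apply: leq_trans le_xy.
- exact: leqnn.
exact: leq_ltn_trans lt_j.
Qed.

Lemma ltn_count_partn mu i j :
  sorted geq mu -> (i < count (ltn j) mu)%N = (j < nth 0 mu i)%N.
Proof.
elim: mu i => [|p mu IHmu] i srt; first by rewrite nth_nil.
have srt' : sorted geq mu by apply: path_sorted srt.
have le_p : all (geq p) mu.
  by apply: order_path_min srt => x y z le_xy le_zx; apply: leq_trans le_xy.
rewrite /=; have [lt_jp | le_pj] := ltnP j p; first by case: i => //= i; apply: IHmu.
have -> : count (ltn j) mu = 0%N.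
  apply/eqP; rewrite -leqn0 leqNgt -has_count -all_predC.
  by apply: sub_all le_p => q /= le_qp; rewrite -leqNgt (leq_trans le_qp).
rewrite ltn0; case: i => [|i] /=; first by rewrite ltnNge le_pj.
have [lt_i | le_i] := ltnP i (size mu); last by rewrite nth_default.
have := allP le_p _ (mem_nth 0 lt_i); rewrite /= => le_qp.
by rewrite ltnNge (leq_trans le_qp).
Qed.

Lemma nth_conj_partn n nu j :
  is_partn n nu -> nth 0 (conj_partn nu) j = count (ltn j) nu.
Proof.
case/and3P=> srt _ _; have [lt_j | le_j] := ltnP j (head 0 nu).
  by rewrite nth_mkseq.
rewrite nth_default ?size_mkseq //; apply/esym/eqP.
by rewrite -leqn0 leqNgt ltn_count_partn // nth0 -leqNgt.
Qed.

Lemma sumn_conj_partn n nu : is_partn n nu -> sumn (conj_partn nu) = n.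
Proof.
move=> nuP; case/and3P: (nuP) => srt _ /eqP <-.
rewrite /conj_partn sumnE big_map -{1}[head 0 nu]subn0 -/(index_iota _ _).
transitivity (\sum_(0 <= j < head 0 nu) \sum_(p <- nu) (j < p : nat))%N.
  by apply: eq_bigr => j _; rewrite -sum1_count big_mkcond.
rewrite exchange_big sumnE; apply: eq_big_seq => p nu_p /=.
have le_p : (p <= head 0 nu)%N.
  rewrite -nth0 -(nth_index 0 nu_p).
  exact: (partn_nth_geq nuP).
rewrite (big_cat_nat _ le_p) //= [X in (_ + X)%N]big_nat_cond.
  rewrite [X in (_ + X)%N]big1 => [|j].
    rewrite addn0 big_nat_cond (eq_bigr (fun=> 1%N)) => [|j]; last first.
      by rewrite andbT => /= ->.
    by rewrite -big_nat_cond sum_nat_const_nat subn0 muln1.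
by rewrite andbT => /andP[le_pj _]; rewrite ltnNge le_pj.
Qed.

Lemma conj_partn_boxes n nu : is_partn n nu -> exists z : 'S_n, forall x,
  box_row (conj_partn nu) x = box_col nu (z x) /\
  box_col (conj_partn nu) x = box_row nu (z x).
Proof.
move=> nuP; have sum_nu' := sumn_conj_partn nuP.
case/and3P: (nuP) => srt _ /eqP sum_nu.
have /fin_all_exists[z0 z0P] (x : 'I_n) : exists y : 'I_n,
    box_row nu y = box_col (conj_partn nu) x /\
    box_col nu y = box_row (conj_partn nu) x.
  apply: (box_exists sum_nu).
  by rewrite -ltn_count_partn // -(nth_conj_partn _ nuP) box_bound.
have inj_z0 : injective z0.
  move=> x y eq_z; apply: (box_inj (mu := conj_partn nu)).
  by have [<- <-] := z0P x; have [<- <-] := z0P y; rewrite eq_z.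
by exists (perm inj_z0) => x; rewrite permE; have [-> ->] := z0P x.
Qed.

Lemma nth_add_partn mu nu i :
  nth 0 (add_partn mu nu) i = (nth 0 mu i + nth 0 nu i)%N.
Proof.
have [lt_i | le_i] := ltnP i (maxn (size mu) (size nu)); first by rewrite nth_mkseq.
rewrite nth_default ?size_mkseq //; move: le_i; rewrite geq_max => /andP[le1 le2].
by rewrite !nth_default.
Qed.

Lemma sumn_add_partn mu nu : sumn (add_partn mu nu) = (sumn mu + sumn nu)%N.
Proof.
pose k := maxn (size mu) (size nu).
have sumE s : (size s <= k)%N -> sumn s = (\sum_(0 <= i < k) nth 0 s i)%N.
  move=> le_s; rewrite sumnE (big_nth 0) (big_cat_nat _ le_s) //=.
  rewrite [X in (_ + X)%N]big_nat_cond [X in (_ + X)%N]big1 ?addn0 // => i.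
  by rewrite andbT => /andP[le_i _]; rewrite nth_default.
rewrite !sumE ?size_mkseq ?leq_maxl ?leq_maxr // -big_split /=.
by apply: eq_bigr => i _; rewrite nth_add_partn.
Qed.

Section AddColumn.

Variables (n b : nat) (mu : seq nat).
Hypothesis muP : is_partn n mu.
Notation mu' := (add_partn mu (nseq b 1%N)).

Lemma nth_add_col i : nth 0 mu' i = (nth 0 mu i + (i < b))%N.
Proof. by rewrite nth_add_partn nth_nseq; case: ifP. Qed.

Lemma sumn_add_col : sumn mu' = (b + n)%N.
Proof.
case/and3P: muP => _ _ /eqP sum_mu.
by rewrite sumn_add_partn sumn_nseq mul1n sum_mu addnC.
Qed.

Lemma add_col_diagram :
  diagram (@box_row (b + n) mu') (@box_col (b + n) mu').
Proof.
apply: box_diagram sumn_add_col _ => i j le_ij; rewrite !nth_add_col.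
apply: leq_add; first exact: (partn_nth_geq muP).
by case: (ltnP j b) => // /(leq_ltn_trans le_ij) ->.
Qed.

Lemma partn_col0 i : (i < size mu)%N ->
  exists x : 'I_n, box_row mu x = i /\ box_col mu x = 0%N.
Proof.
case/and3P: muP => _ nz_mu /eqP sum_mu lt_i; apply: (box_exists sum_mu).
by rewrite lt0n; apply: contraNneq nz_mu => <-; apply: mem_nth.
Qed.

Lemma add_col_col0 i : (i < maxn b (size mu))%N ->
  exists x : 'I_(b + n), box_row mu' x = i /\ box_col mu' x = 0%N.
Proof.
rewrite leq_max => lt_i; apply: (box_exists sumn_add_col).
rewrite nth_add_col addn_gt0 lt0b orbC; case/orP: lt_i => [-> // | lt_i].
case/and3P: muP => _ nz_mu _.
rewrite orbC lt0n; apply/orP; left.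
by apply: contraNneq nz_mu => <-; apply: mem_nth.
Qed.

Lemma add_col_shift (x : 'I_n) : (box_row mu x < b)%N ->
  exists y : 'I_(b + n),
    box_row mu' y = box_row mu x /\ box_col mu' y = (box_col mu x).+1.
Proof.
move=> lt_b; apply: (box_exists sumn_add_col); rewrite nth_add_col lt_b addn1 ltnS.
by case/and3P: muP => _ _ /eqP sum_mu; apply: box_bound.
Qed.

End AddColumn.

(** * Fillings *)

Lemma fiber_perm (X : eqType) n (f f' : 'I_n -> X) :
    (forall y, #|[pred x | f x == y]| = #|[pred x | f' x == y]|) ->
  exists g : 'S_n, forall x, f' x = f (g x).
Proof.
move=> eq_card; pose t := [tuple f i | i < n]; pose t' := [tuple f' i | i < n].
have countE (h : 'I_n -> X) y :
    count_mem y [tuple h i | i < n] = #|[pred x | h x == y]|.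
  rewrite /= count_map cardE -size_filter enumT; congr size; exact: eq_filter.
have : perm_eq t' t by apply/allP => y _ /=; rewrite !countE eq_card.
case/tuple_permP=> g /val_inj eq_t; exists g => x.
by have := congr1 (fun s => tnth s x) eq_t; rewrite !tnth_mktuple => ->.
Qed.

Section PermModules.

Variables (F : fieldType) (gT : finGroupType) (T : finType).
Variable to : {action gT &-> T}.

Lemma basis_vecE x y : basis_vec F x 0 (enum_rank y) = (x == y :> T)%:R.
Proof. by rewrite mxE eqxx /= (inj_eq enum_rank_inj) eq_sym. Qed.

Lemma basis_vecP n (A B : 'M[F]_(#|T|, n)) :
  (forall x, basis_vec F x *m A = basis_vec F x *m B) -> A = B.
Proof.
by move=> eqAB; apply/row_matrixP=> k; rewrite !rowE -[k]enum_valK eqAB.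
Qed.

Lemma perm_module_tr g : (perm_module F to g)^T = perm_module F to g^-1%g.
Proof.
apply/matrixP=> k l; rewrite !mxE -[k]enum_valK -[l]enum_valK !enum_rankK.
rewrite !eqxx /= !(inj_eq enum_rank_inj).
by rewrite eq_sym (can2_eq (actK to g) (actKV to g)).
Qed.

End PermModules.

Lemma fsum_tr (F : fieldType) m (T : finType) (to : {action 'S_m &-> T}) e f :
  (fsum (perm_module F to) e f)^T = fsum (perm_module F to) e f.
Proof.
rewrite fsum.unlock raddf_sum [RHS](reindex_inj invg_inj) /=.
apply: eq_big => [g | g _]; first by rewrite groupV.
by rewrite linearZ /= perm_module_tr sgnV.
Qed.

Section Fillings.

Variables n b a : nat.

Definition balanced (T : {ffun 'I_n -> 'I_b}) :=
  [forall i, #|[pred x | T x == i]| == a].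

Definition filling : predArgType := {T | balanced T}.
HB.instance Definition _ := SubFinite.on filling.

Definition letter (T : filling) (x : 'I_n) : 'I_b := val T x.

Lemma letter_card T i : #|[pred x | letter T x == i]| = a.
Proof. by apply/eqP; have /forallP := valP T; apply. Qed.

Lemma filling_eq (T T' : filling) : letter T =1 letter T' -> T = T'.
Proof. by move=> eqT; apply/val_inj/ffunP. Qed.

Lemma balancedP (f : 'I_n -> 'I_b) :
  (forall i, #|[pred x | f x == i]| = a) -> balanced (finfun f).
Proof.
move=> card_f; apply/forallP=> i; rewrite -(card_f i); apply/eqP.
by apply: eq_card => x; rewrite !inE ffunE.
Qed.

Definition Filling f card_f : filling := Sub (finfun f) (balancedP card_f).

Lemma FillingE f card_f x : letter (@Filling f card_f) x = f x.
Proof. by rewrite /letter ffunE. Qed.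

Lemma place_card T (g : 'S_n) i : #|[pred x | letter T (g^-1 x)%g == i]| = a.
Proof.
rewrite -[RHS](letter_card T i) -!sum1_card.
by rewrite [RHS](reindex_inj (@perm_inj _ g^-1%g)).
Qed.

Definition place T (g : 'S_n) : filling := Filling (place_card T g).

Lemma placeE T g x : letter (place T g) x = letter T (g^-1 x)%g.
Proof. exact: FillingE. Qed.

Lemma relabel_card T (s : 'S_b) i : #|[pred x | s (letter T x) == i]| = a.
Proof.
rewrite -[RHS](letter_card T (s^-1 i)%g).
by apply: eq_card => x; rewrite !inE (canF_eq (permK s)).
Qed.

Definition relabel T (s : 'S_b) : filling := Filling (relabel_card T s).

Lemma relabelE T s x : letter (relabel T s) x = s (letter T x).
Proof. exact: FillingE. Qed.

Lemma place1 : place^~ 1%g =1 id.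
Proof. by move=> T; apply: filling_eq => x; rewrite placeE invg1 perm1. Qed.

Lemma placeM T : act_morph place T.
Proof.
by move=> g h; apply: filling_eq => x; rewrite !placeE invMg permM.
Qed.

Lemma relabel1 : relabel^~ 1%g =1 id.
Proof. by move=> T; apply: filling_eq => x; rewrite relabelE perm1. Qed.

Lemma relabelM T : act_morph relabel T.
Proof. by move=> g h; apply: filling_eq => x; rewrite !relabelE permM. Qed.

Definition place_action := TotalAction place1 placeM.
Definition relabel_action := TotalAction relabel1 relabelM.

Lemma relabel_place T g s : relabel (place T g) s = place (relabel T s) g.
Proof. by apply: filling_eq => x; rewrite !(placeE, relabelE). Qed.

Lemma place_trans T T' : exists g, T' = place T g.
Proof.
have [g gP] : exists g : 'S_n, forall x, letter T' x = letter T (g x).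
  by apply: fiber_perm => i; rewrite !letter_card.
by exists g^-1%g; apply: filling_eq => x; rewrite placeE invgK gP.
Qed.

Section Modules.

Variable F : fieldType.

Definition place_module := perm_module F place_action.
Definition relabel_module := perm_module F relabel_action.

Lemma mul_place m (v : 'M_(m, #|filling|)) g r T :
  (v *m place_module g) r (enum_rank T) = v r (enum_rank (place T g^-1)).
Proof.
rewrite mxE (bigD1 (enum_rank (place T g^-1))) //= big1 => [|j ne_j].
  rewrite addr0 mxE enum_rankK basis_vecE /= -placeM.
  by rewrite mulVg place1 eqxx mulr1.
rewrite mxE basis_vecE /=; case: eqP => [eq_T | _]; last by rewrite mulr0.
by case/eqP: ne_j; rewrite -eq_T -placeM mulgV place1 enum_valK.
Qed.

Lemma place_relabel_mx g s :
  place_module g *m relabel_module s = relabel_module s *m place_module g.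
Proof.
by apply: basis_vecP => T; rewrite !mulmxA !basis_vec_act /= relabel_place.
Qed.

Lemma place_fsum_relabel g e f :
  place_module g *m fsum relabel_module e f
    = fsum relabel_module e f *m place_module g.
Proof.
rewrite fsum.unlock mulmx_sumr mulmx_suml; apply: eq_bigr => s _.
by rewrite -scalemxAr -scalemxAl place_relabel_mx.
Qed.

Lemma fsum_place_relabel e f s :
  fsum place_module e f *m relabel_module s
    = relabel_module s *m fsum place_module e f.
Proof.
rewrite fsum.unlock mulmx_sumr mulmx_suml; apply: eq_bigr => g _.
by rewrite -scalemxAr -scalemxAl place_relabel_mx.
Qed.

Lemma place_relabel_comm e f e' f' :
  fsum place_module e f *m fsum relabel_module e' f'
    = fsum relabel_module e' f' *m fsum place_module e f.
Proof.
rewrite -[in RHS](addbF e); apply: fsum_hom => g.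
by rewrite /sgn scale1r place_fsum_relabel.
Qed.

End Modules.

End Fillings.

(** * Foulkes modules *)

Section FoulkesRank.

Variables (F : numFieldType) (a b : nat) (nu : seq nat).
Hypotheses (a_gt0 : (0 < a)%N) (D : diagram (@box_row b nu) (@box_col b nu)).

Notation Om := (filling (a * b) b a).
Notation N := (place_module (a * b) b a F).
Notation N' := (relabel_module (a * b) b a F).
Notation U := (specht_mx F b nu).
Notation Pb := (tabloid_module F b).
Notation H := (wreath a b).

Lemma block_of_subproof (x : 'I_(a * b)) : (x %/ a < b)%N.
Proof. by rewrite ltn_divLR // [(b * a)%N]mulnC. Qed.

Definition block_of x : 'I_b := Ordinal (block_of_subproof x).

Lemma mem_block x (i : 'I_b) : (x \in block a i) = (block_of x == i).
Proof. by rewrite inE. Qed.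

Lemma block_of_card i : #|[pred x | block_of x == i]| = a.
Proof.
have lt_ki (k : 'I_a) : (i * a + k < a * b)%N.
  apply: leq_trans (_ : i.+1 * a <= _)%N; first by rewrite mulSn addnC ltn_add2r.
  by rewrite mulnC leq_mul2l ltn_ord orbT.
pose h k := Ordinal (lt_ki k).
rewrite -[RHS]card_ord -(card_codom (f := h)) => [|k l /(congr1 val)/=/addnI/val_inj//].
apply: eq_card => x; rewrite inE; apply/eqP/codomP => [def_i | [k ->]].
  exists (Ordinal (ltn_pmod x a_gt0)); apply: val_inj => /=.
  by rewrite -def_i; apply: divn_eq.
by apply: val_inj; rewrite /= divnMDl // divn_small ?addn0.
Qed.

Definition T0 : Om := Filling block_of_card.

Lemma T0E x : letter T0 x = block_of x. Proof. exact: FillingE. Qed.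

Lemma T0_onto i : exists x, letter T0 x = i.
Proof.
have /card_gt0P[x] : (0 < #|[pred x | letter T0 x == i]|)%N by rewrite letter_card.
by rewrite inE => /eqP; exists x.
Qed.

Lemma relabel_T0_inj : injective (relabel T0).
Proof.
move=> s t eq_st; apply/permP=> i; have [x <-] := T0_onto i.
by rewrite -!relabelE eq_st.
Qed.

Lemma place_T0 h : h \in H -> place T0 h = relabel T0 (block_perm h)^-1.
Proof.
move=> Hh; apply: filling_eq => x; rewrite placeE relabelE !T0E.
apply: (canRL (permK _)); apply/esym/eqP; rewrite -mem_block -block_permP //.
by apply/imsetP; exists (h^-1 x)%g; rewrite ?permKV // mem_block.
Qed.

Lemma wreath_place g s : place T0 g = relabel T0 s -> g \in H.
Proof.
move=> eq_g; have eqT x : block_of x = s (block_of (g x)).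
  by rewrite -[in LHS](permK g x) -!T0E -placeE eq_g relabelE.
have gB i : g @: block a i = block a (s^-1 i)%g.
  apply/setP=> y; rewrite mem_block; apply/imsetP/eqP => [[x Bx ->] | eq_y].
    by move: Bx; rewrite mem_block eqT => /eqP <-; rewrite permK.
  exists (g^-1 y)%g; last by rewrite permKV.
  by rewrite mem_block eqT permKV eq_y permKV.
rewrite !inE; apply/subsetP=> _ /imsetP[i _ ->]; rewrite inE /=.
by rewrite /setact /= gB; apply: imset_f.
Qed.

Definition fill_mx : 'M[F]_(#|{set 'S_b}|, #|Om|) :=
  \matrix_k \sum_(s in (enum_val k : {set 'S_b})) basis_vec F (relabel T0 s^-1).

Lemma fill_mxE A :
  basis_vec F A *m fill_mx = \sum_(s in A) basis_vec F (relabel T0 s^-1).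
Proof. by rewrite -rowE rowK enum_rankK. Qed.

Lemma fill_mx_hom h : h \in H ->
  Pb (block_perm h) *m fill_mx = fill_mx *m N h.
Proof.
move=> Hh; apply: basis_vecP => A; rewrite !mulmxA basis_vec_act !fill_mxE /=.
rewrite mulmx_suml [LHS](reindex_inj (mulIg (block_perm h))) /=.
apply: eq_big => [s | s _]; first by rewrite rcosetE mem_rcoset mulgK.
rewrite basis_vec_act /= -relabel_place place_T0 //; congr basis_vec.
by rewrite invMg relabelM.
Qed.

Notation Q := (fsum N' true (@box_col b nu) *m fsum N' false (@box_row b nu)).

Lemma polytabloid_fill t :
  polytabloid F nu t *m fill_mx = basis_vec F (relabel T0 t^-1) *m Q.
Proof.
rewrite polytabloidE !fsum.unlock mulmx_sumr !mulmx_suml mulmx_sumr.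
rewrite [RHS](reindex_inj invg_inj) /=; apply: eq_big => [p | p _].
  by rewrite groupV.
rewrite -scalemxAr -!scalemxAl -scalemxAr sgnV; congr (_ *: _).
rewrite !basis_vec_act fill_mxE mulmx_sumr mulmx_sumr.
rewrite [RHS](reindex_inj invg_inj) /=.
rewrite [LHS](reindex_inj (mulIg (p * t)%g)) /=; apply: eq_big => [r | r _].
  rewrite !rcosetE groupV !mem_rcoset tabloid1 -mulgA.
  by rewrite !mulgA !mulgK.
rewrite scale1r mulmxA !basis_vec_act /= !invMg.
by rewrite -!relabelM mulgA.
Qed.

Notation V1 := (val_submod (1%:M : 'M_(\rank U))).
Definition foulkes_block : 'M[F]_(\rank U, #|Om|) := V1 *m fill_mx.

Lemma foulkes_block_hom h : h \in H ->
  inflated_specht a b F nu h *m foulkes_block = foulkes_block *m N h.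
Proof.
move=> Hh; have homV : inflated_specht a b F nu h *m V1
    = V1 *m Pb (block_perm h).
  by apply: (submod_hom (specht_mx_module F b nu)); rewrite inE.
by rewrite /foulkes_block [LHS]mulmxA homV -[LHS]mulmxA fill_mx_hom // [LHS]mulmxA.
Qed.

Lemma polytabloid_notin (A : {set 'S_b}) t : (forall s, A != tabloid nu s) ->
  polytabloid F nu t 0 (enum_rank A) = 0.
Proof.
move=> notA; rewrite summxE big1 // => p _; rewrite mxE basis_vecE.
by rewrite eq_sym (negPf (notA _)) mulr0.
Qed.

Lemma mem_tabloid (s t : 'S_b) : (s \in tabloid nu t) = (tabloid nu s == tabloid nu t).
Proof.
have tE u : tabloid nu u = fiber_stab (@box_row b nu) :* u.
  by rewrite -[u in LHS]mul1g -tabloid_act tabloid1.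
rewrite !tE; apply/idP/eqP => [/rcoset_eqP-> // | <-]; exact: rcoset_refl.
Qed.

Lemma fill_mx_inj n (W : 'M_(n, _)) : (W <= U)%MS -> W *m fill_mx = 0 -> W = 0.
Proof.
move=> sWU Wf0; apply/row_matrixP=> i; rewrite row0.
have: (row i W <= U)%MS by apply: submx_trans (row_sub _ _) sWU.
have: row i W *m fill_mx = 0 by rewrite -row_mul Wf0 row0.
move: (row i W) => w wf0 wU.
have w_notin A : (forall s, A != tabloid nu s) -> w 0 (enum_rank A) = 0.
  move=> notA; have [u ->] := submxP wU.
  pose d : 'cV[F]_#|{set 'S_b}| := delta_mx (enum_rank A) 0.
  have Ud : U *m d = 0.
    apply/eqP; rewrite -submx0 sumsmxMr_gen; apply/sumsmx_subP=> t _.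
    rewrite genmxE (eqmxMr _ (genmxE _)) submx0 /d -colE.
    by apply/eqP/matrixP=> k l; rewrite !ord1 !mxE polytabloid_notin.
  have := congr1 (fun M : 'cV_1 => M 0 0) (congr1 (mulmx u) Ud).
  by rewrite mulmxA mulmx0 /d -colE !mxE.
apply/rowP=> k; rewrite !mxE -[k]enum_valK; move: (enum_val k) => A {k}.
have [[s /eqP->] | notA] := pselect (exists s, A == tabloid nu s); last first.
  by apply: w_notin => s; apply/negP => As; apply: notA; exists s.
have := congr1 (fun M : 'rV_#|Om| => M 0 (enum_rank (relabel T0 s^-1))) wf0.
have -> : w = \sum_A w 0 (enum_rank A) *: basis_vec F A.
  rewrite [LHS]row_sum_delta (reindex enum_rank) //.
  exact/onW_bij/enum_rank_bij.
rewrite mulmx_suml summxE mxE summxE => sum0; rewrite -[RHS]sum0.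
apply: eq_bigr => B _; rewrite -scalemxAl mxE [RHS]mxE basis_vecE fill_mxE summxE.
have [[t /eqP->] | notB] := pselect (exists t, B == tabloid nu t); last first.
  rewrite w_notin ?mul0r // => t.
  by apply/negP => Bt; apply: notB; exists t.
congr (_ * _); rewrite eq_sym -mem_tabloid.
under eq_bigr => u _ do
  rewrite basis_vecE (inj_eq relabel_T0_inj) (inj_eq invg_inj).
rewrite big_mkcond (bigD1 s) //= eqxx big1 ?addr0 => [|u /negPf ->].
  by case: ifP.
by case: ifP.
Qed.

Lemma foulkes_block_free : row_free foulkes_block.
Proof.
rewrite -kermx_eq0; set K := kermx _.
have : K *m V1 *m fill_mx = 0 by rewrite -mulmxA mulmx_ker.
move/fill_mx_inj => KV0.
have : K *m V1 = 0 by apply: KV0; rewrite -val_submodE val_submodP.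
rewrite -val_submodE => /eqP K0.
by rewrite -(inj_eq (@val_submod_inj _ _ U _)) (eqP K0) /val_submod /= mul0mx.
Qed.

Notation k i := (@coset_rep _ H [set: 'S_(a * b)]%G i).

Definition foulkes_fill :
    'M[F]_(\sum_(i < #|[set: 'S_(a * b)] : H|) \rank U, #|Om|) :=
  \mxcol_i (foulkes_block *m N (k i)).

Lemma foulkes_fill_hom g :
  foulkes a b F nu g *m foulkes_fill = foulkes_fill *m N g.
Proof.
rewrite /foulkes_fill mxcol_mul /= /induced_mx mul_mxblock_mxrow.
apply: eq_mxcol => i; have [j Hj] := coset_rep_of (subsetT H) (in_setT (k i * g)%g).
rewrite (bigD1 j) //= big1 => [|l ne_lj]; last first.
  by rewrite /induced_block Hj (negPf ne_lj) mul0mx.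
rewrite addr0 /induced_block Hj eqxx mulmxA foulkes_block_hom ?Hj ?eqxx //.
by rewrite -[LHS]mulmxA -[RHS]mulmxA -reprM mulgKV reprM.
Qed.

Lemma foulkes_block_support n (v : 'M_(n, _)) r T :
  (forall s, T != relabel T0 s) -> (v *m foulkes_block) r (enum_rank T) = 0.
Proof.
move=> notT; rewrite mulmxA mxE big1 // => j _.
rewrite -[j]enum_valK; move: (enum_val j) => A; rewrite [X in _ * X]mxE.
rewrite enum_rankK summxE big1 ?mulr0 // => s _.
by rewrite basis_vecE eq_sym (negPf (notT _)).
Qed.

Lemma foulkes_fill_free : row_free foulkes_fill.
Proof.
rewrite -kermx_eq0; apply/eqP; move: (kermx _) (mulmx_ker foulkes_fill) => K K0.
rewrite -[K]submxrowK; apply/eqP; rewrite -[X in _ == X]submxrowK.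
apply/eqP/eq_mxrow => i; rewrite submxrow0.
apply: (row_free_inj foulkes_block_free); rewrite mul0mx.
apply/matrixP=> r c; rewrite -[c]enum_valK; move: (enum_val c) => T {c}.
rewrite [RHS]mxE.
have [[s eq_T] | notT] := pselect (exists s, T == relabel T0 s); last first.
  by apply: foulkes_block_support => s; apply/negP => Ts; apply: notT; exists s.
have := congr1 (fun M : 'M_(_, _) => M r (enum_rank (place T (k i)))) K0.
rewrite -[K in K *m _]submxrowK mul_mxrow_mxcol summxE mxE => K0T.
apply: etrans K0T; rewrite [RHS](bigD1 i) //= [X in _ + X]big1 => [|j ne_ji].
  by rewrite addr0 [_ *m (foulkes_block *m _)]mulmxA mul_place -placeM mulgV place1.
rewrite [_ *m (foulkes_block *m _)]mulmxA mul_place -placeM foulkes_block_support // => t.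
rewrite (eqP eq_T) -relabel_place; apply/negP => /eqP eq_t.
have : (k i * (k j)^-1)%g \in H.
  apply: (wreath_place (s := (t * s^-1)%g)).
  apply: (act_inj (relabel_action _ _ _) s) => /=.
  by rewrite eq_t -relabelM mulgKV.
have [l Hl] := coset_rep_of (subsetT H) (in_setT (k i)).
rewrite Hl; move/eqP=> eq_lj; have := Hl i; rewrite mulgV group1 => /esym/eqP eq_li.
by case/eqP: ne_ji; rewrite eq_lj.
Qed.

Lemma place_relabel g : N g *m Q = Q *m N g.
Proof.
rewrite [LHS]mulmxA place_fsum_relabel -[LHS]mulmxA place_fsum_relabel.
by rewrite [LHS]mulmxA.
Qed.

Lemma fill_T0 : basis_vec F T0 *m Q = polytabloid F nu 1%g *m fill_mx.
Proof. by rewrite polytabloid_fill invg1 relabel1. Qed.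

Lemma foulkes_fill_eq : (foulkes_fill :=: Q)%MS.
Proof.
apply/eqmxP/andP; split.
  have fillQ : (U *m fill_mx <= Q)%MS.
    rewrite sumsmxMr_gen; apply/sumsmx_subP=> t _.
    by rewrite genmxE (eqmxMr _ (genmxE _)) polytabloid_fill submxMl.
  have /submxP[C def_C] : (foulkes_block <= Q)%MS.
    exact: submx_trans (submxMr _ (val_submodP _)) fillQ.
  have blockQ i : foulkes_block *m N (k i) = C *m N (k i) *m Q.
    by rewrite def_C -[LHS]mulmxA -place_relabel [LHS]mulmxA.
  rewrite /foulkes_fill; under eq_mxcol do rewrite blockQ.
  by rewrite -mxcol_mul submxMl.
have sub_block i : (foulkes_block *m N (k i) <= foulkes_fill)%MS.
  pose E := \mxrow_j (if j == i then 1%:M else 0 : 'M[F]_(\rank U)).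
  apply/submxP; exists E; rewrite mul_mxrow_mxcol [RHS](bigD1 i) //= eqxx mul1mx.
  by rewrite [X in _ + X]big1 ?addr0 // => j /negPf ->; rewrite mul0mx.
apply/row_subP=> r; rewrite rowE -[r]enum_valK; move: (enum_val r) => T {r}.
have [g ->] := place_trans T0 T.
have [j Hj] := coset_rep_of (subsetT H) (in_setT g).
have Hh : (g * (k j)^-1)%g \in H by rewrite Hj.
have actN : basis_vec F (place T0 g) = basis_vec F T0 *m N g.
  by rewrite basis_vec_act.
rewrite -/(basis_vec F (place T0 g)) actN -mulmxA place_relabel mulmxA fill_T0.
rewrite -(mulgKV (k j) g) reprM mulmxA -[_ *m fill_mx *m _]mulmxA.
rewrite -fill_mx_hom // mulmxA polytabloid_act -(in_submodK (polytabloid_sub _ _ _)).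
rewrite val_submodE -[_ *m V1 *m _]mulmxA -mulmxA.
exact: mulmx_sub.
Qed.

Lemma rank_foulkes e1 f1 e2 f2 :
  \rank (fsum (foulkes a b F nu) e1 f1 *m fsum (foulkes a b F nu) e2 f2)
    = \rank (Q *m (fsum N e1 f1 *m fsum N e2 f2)).
Proof.
have homX e f : fsum (foulkes a b F nu) e f *m foulkes_fill
    = foulkes_fill *m fsum N e f.
  rewrite -[in RHS](addbF e); apply: fsum_hom => g.
  by rewrite /sgn scale1r foulkes_fill_hom.
rewrite -(mxrankMfree _ foulkes_fill_free) -(eqmxMr _ foulkes_fill_eq).
by congr (\rank _); rewrite -[LHS]mulmxA homX mulmxA homX -mulmxA.
Qed.

End FoulkesRank.

(** * Products of column minors *)

Lemma eq_rank_ker (F : fieldType) m n1 n2 (A : 'M[F]_(m, n1)) (B : 'M[F]_(m, n2)) :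
    (forall v : 'rV_m, v *m A = 0 <-> v *m B = 0) -> \rank A = \rank B.
Proof.
move=> eqAB; have eqK : (kermx A == kermx B)%MS.
  apply/andP; split; apply/row_subP=> r; apply/sub_kermxP; apply/eqAB.
    by apply/sub_kermxP; apply: row_sub.
  by apply/sub_kermxP; apply: row_sub.
apply/eqP; rewrite -(eqn_sub2lE (rank_leq_row A) (rank_leq_row B)).
by rewrite -!mxrank_ker (eqmxP eqK).
Qed.

Lemma det_reindex (R : comNzRingType) n (s : 'S_n) (A : 'M[R]_n) :
  \det (\matrix_(x, y) A (s x) (s y)) = \det A.
Proof.
rewrite (_ : \matrix_(x, y) _ = row_perm s (col_perm s A)); last first.
  by apply/matrixP=> x y; rewrite !mxE.
rewrite row_permE col_permE !det_mulmx !det_perm odd_permV.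
by rewrite mulrC -mulrA -signr_addb addbb mulr1.
Qed.

Section Monomials.

Variables (F : numFieldType) (b : nat).

Notation E := {mpoly F[#|{: 'I_b * 'I_b}|]}.
Definition var (i j : 'I_b) : E := 'X_(enum_rank (i, j)).

Definition var_mx : 'M[E]_b := \matrix_(i, j) var i j.

Lemma det_var_neq0 : \det var_mx != 0.
Proof.
pose v (k : 'I_#|{: 'I_b * 'I_b}|) : F := ((enum_val k).1 == (enum_val k).2)%:R.
apply: contraTneq (oner_neq0 F) => det0; rewrite negbK.
have: (meval v) (\det var_mx) = 0 by rewrite det0 raddf0.
rewrite -det_map_mx (_ : map_mx _ _ = 1%:M) ?det1 => [->//|].
by apply/matrixP=> i j; rewrite !mxE /= /var mevalXU /v enum_rankK.
Qed.

Section Shape.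

Variables (n a : nat) (ri : 'I_n -> 'I_b) (cl : 'I_n -> nat).

Notation Om := (filling n b a).
Notation N := (place_module n b a F).
Notation rw := (fun x => ri x : nat).
Notation rsym := (fsum N false rw).
Notation calt := (fsum N true cl).

Definition mon (T : Om) : E := \prod_x var (ri x) (letter T x).

Definition theta (v : 'rV[F]_#|Om|) : E := \sum_T v 0 (enum_rank T) *: mon T.

Lemma theta_is_linear : linear theta.
Proof.
move=> c u v; rewrite /theta scaler_sumr -big_split /=.
by apply: eq_bigr => T _; rewrite !mxE scalerDl scalerA.
Qed.
HB.instance Definition _ := GRing.isLinear.Build F 'rV[F]_#|Om| E _ theta
  theta_is_linear.

Lemma theta_basis T : theta (basis_vec F T) = mon T.
Proof.
rewrite /theta (bigD1 T) //= big1 ?addr0 => [|T' /negPf ne_T].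
  by rewrite basis_vecE eqxx scale1r.
by rewrite basis_vecE eq_sym ne_T scale0r.
Qed.

Lemma row_basis (v : 'rV[F]_#|Om|) :
  v = \sum_T v 0 (enum_rank T) *: basis_vec F T.
Proof.
rewrite [LHS]row_sum_delta (reindex enum_rank) //.
exact/onW_bij/enum_rank_bij.
Qed.

Lemma mon_place T g : g \in fiber_stab rw -> mon (place T g) = mon T.
Proof.
move/fiber_stabP=> Rg; rewrite /mon (reindex_inj (@perm_inj _ g)) /=.
apply: eq_bigr => x _; rewrite placeE permK; congr var.
exact/val_inj/Rg.
Qed.

Lemma theta_place v g : g \in fiber_stab rw -> theta (v *m N g) = theta v.
Proof.
move=> Rg; rewrite [v]row_basis mulmx_suml !raddf_sum.
apply: eq_bigr => T _; rewrite /= -scalemxAl !linearZ /= basis_vec_act.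
by rewrite !theta_basis /= mon_place.
Qed.

Lemma theta_rsym v : theta (v *m rsym) = #|fiber_stab rw|%:R *: theta v.
Proof.
rewrite fsum.unlock mulmx_sumr raddf_sum scaler_nat -sumr_const.
by apply: eq_bigr => g Rg; rewrite scale1r -[RHS](theta_place _ Rg).
Qed.

Definition mon_deg (T : Om) : 'X_{1..#|{: 'I_b * 'I_b}|} :=
  (\sum_x U_(enum_rank (ri x, letter T x)))%MM.

Lemma monE T : mon T = 'X_[mon_deg T].
Proof. by rewrite /mon mprodXE. Qed.

Lemma mon_deg_place T T' : mon_deg T' = mon_deg T ->
  exists2 g, g \in fiber_stab rw & T' = place T g.
Proof.
move=> eq_deg; have degE (S : Om) i j :
    mon_deg S (enum_rank (i, j)) = #|[pred x | (ri x, letter S x) == (i, j)]|.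
  rewrite mnm_sumE -[RHS]sum1_card [RHS]big_mkcond; apply: eq_bigr => x _.
  by rewrite mnm1E (inj_eq enum_rank_inj) inE; case: (_ == _).
have [|g gP] := @fiber_perm _ n (fun x => (ri x, letter T x))
    (fun x => (ri x, letter T' x)).
  by case=> i j; rewrite -!degE eq_deg.
exists g^-1%g.
  by rewrite groupV; apply/fiber_stabP=> x; have [-> _] := gP x.
by apply: filling_eq => x; rewrite placeE invgK; have [_ ->] := gP x.
Qed.

Lemma theta_eq0 v : v *m rsym = 0 <-> theta v = 0.
Proof.
split=> [v0 | th0].
  have := theta_rsym v; rewrite v0 raddf0 => /esym/eqP.
  by rewrite scaler_eq0 pnatr_eq0 eqn0Ngt cardG_gt0 => /eqP.
have := theta_rsym v; rewrite th0 scaler0.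
have: forall g, g \in fiber_stab rw -> v *m rsym *m N g = v *m rsym.
  by move=> g Rg; rewrite -mulmxA fsumMr // scale1r.
move: (v *m rsym) => w wR thw0.
apply/rowP=> k; rewrite mxE -[k]enum_valK; move: (enum_val k) => T {k}.
have := congr1 (mcoeff (mon_deg T)) thw0; rewrite raddf_sum raddf0 /=.
rewrite (eq_bigr (fun T' => if mon_deg T' == mon_deg T
  then w 0 (enum_rank T) else 0)) => [|T' _]; last first.
  rewrite mcoeffZ monE mcoeffX; case: eqP => [/mon_deg_place|]; last by rewrite mulr0.
  case=> g Rg ->; rewrite mulr1 -[in RHS](wR g^-1%g) ?groupV //.
  by rewrite mul_place invgK.
rewrite -big_mkcond sumr_const => /eqP; rewrite mulrn_eq0 => /orP[|/eqP//].
by move=> /eqP/card0_eq/(_ T) eq0; have := etrans (esym (eqxx (mon_deg T))) eq0.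
Qed.

Definition tableau_mx (T : Om) : 'M[E]_n :=
  \matrix_(x, y) if cl x == cl y then var (ri x) (letter T y) else 0.

Lemma theta_calt T : theta (basis_vec F T *m calt) = \det (tableau_mx T).
Proof.
rewrite fsum.unlock mulmx_sumr raddf_sum [LHS](reindex_inj invg_inj) /=.
rewrite big_mkcond; apply: eq_bigr => s _; rewrite groupV sgnV.
rewrite -scalemxAr linearZ /= basis_vec_act theta_basis /=.
case: ifPn => [/fiber_stabP Cs | notC].
  rewrite /sgn /= scaler_sign mulr_sign /mon.
  suffices -> : \prod_x var (ri x) (letter (place T s^-1) x)
      = \prod_x tableau_mx T x (s x) by [].
  by apply: eq_bigr => x _; rewrite !mxE Cs eqxx placeE invgK.
have [x ne_x] : exists x, cl (s x) != cl x.
  by apply/existsP; rewrite -negb_forall; move: notC; rewrite inE.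
by rewrite (bigD1 x) //= mxE eq_sym (negPf ne_x) mul0r mulr0.
Qed.

End Shape.
End Monomials.

Section ExtraColumn.

Variables (F : numFieldType) (n a b : nat).
Variables (ri : 'I_n -> 'I_b) (cl : 'I_n -> nat).
Variables (ri' : 'I_(b + n) -> 'I_b) (cl' : 'I_(b + n) -> nat).
Variables (kappa : 'I_b -> 'I_(b + n)) (iota : 'I_n -> 'I_(b + n)).
Hypothesis inj_d : injective (fun x => (ri x, cl x)).
Hypothesis kappaP : forall i, ri' (kappa i) = i /\ cl' (kappa i) = 0%N.
Hypothesis iotaP : forall x, ri' (iota x) = ri x /\ cl' (iota x) = (cl x).+1.

Notation Om := (filling n b a).
Notation Om' := (filling (b + n) b a.+1).
Notation N := (place_module n b a F).
Notation N' := (place_module (b + n) b a.+1 F).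
Notation L := (relabel_module n b a F).
Notation L' := (relabel_module (b + n) b a.+1 F).
Notation E := {mpoly F[#|{: 'I_b * 'I_b}|]}.

Definition split_box (x : 'I_(b + n)) : 'I_(b + n) :=
  match split x with inl i => kappa i | inr y => iota y end.

Lemma split_box_l i : split_box (lshift n i) = kappa i.
Proof. by rewrite /split_box (unsplitK (inl i)). Qed.

Lemma split_box_r x : split_box (rshift b x) = iota x.
Proof. by rewrite /split_box (unsplitK (inr x)). Qed.

Lemma split_box_inj : injective split_box.
Proof.
move=> x y; rewrite -[x]splitK -[y]splitK.
case: (split x) => u; case: (split y) => v; rewrite /= ?split_box_l ?split_box_r => eq_b.
- by have [<- _] := kappaP u; have [<- _] := kappaP v; rewrite eq_b.
- by have [_] := kappaP u; have [_] := iotaP v; rewrite eq_b => ->.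
- by have [_] := kappaP v; have [_] := iotaP u; rewrite eq_b => ->.
congr rshift; apply: inj_d; have [r1 c1] := iotaP u; have [r2 c2] := iotaP v.
by rewrite -r1 -r2 eq_b; congr (_, _); apply: succn_inj; rewrite -c1 -c2 eq_b.
Qed.

Definition box_perm : 'S_(b + n) := perm split_box_inj.

Lemma det_tableau_split T' T : (forall x, letter T' (iota x) = letter T x) ->
  \det (tableau_mx F ri' cl' (T' : Om')) =
  \det (\matrix_(i, j) var F i (letter T' (kappa j)))
    * \det (tableau_mx F ri cl (T : Om)).
Proof.
move=> eqT; set B := \matrix_(_, _) _.
rewrite -(det_reindex box_perm); set M := \matrix_(_, _) _.
have Mur : ursubmx M = 0.
  apply/matrixP=> i x; rewrite !mxE !permE split_box_l split_box_r.
  by have [_ ->] := kappaP i; have [_ ->] := iotaP x.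
have Mul : ulsubmx M = B.
  apply/matrixP=> i j; rewrite !mxE !permE !split_box_l.
  by have [-> ->] := kappaP i; have [_ ->] := kappaP j; rewrite eqxx.
have Mdr : drsubmx M = tableau_mx F ri cl T.
  apply/matrixP=> x y; rewrite !mxE !permE !split_box_r eqT.
  by have [-> ->] := iotaP x; have [_ ->] := iotaP y; rewrite eqSS.
by rewrite -[M]submxK Mur Mul Mdr det_lblock.
Qed.

Lemma card_split (P : pred 'I_(b + n)) :
  #|P| = (#|[pred i | P (kappa i)]| + #|[pred x | P (iota x)]|)%N.
Proof.
rewrite -!sum1_card [LHS](reindex_inj (@perm_inj _ box_perm)) big_split_ord /=.
by congr (_ + _)%N; apply: eq_bigl => x; rewrite permE ?split_box_l ?split_box_r.
Qed.

Lemma split_cover x' : (exists i, x' = kappa i) \/ (exists x, x' = iota x).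
Proof.
rewrite -[x'](permKV box_perm) permE; move: (_ x') => y.
rewrite -[y]splitK; case: (split y) => u /=; rewrite ?split_box_l ?split_box_r.
  by left; exists u.
by right; exists u.
Qed.

Definition glue_letter (t : 'S_b) (T : Om) (x' : 'I_(b + n)) : 'I_b :=
  match split (box_perm^-1 x')%g with inl i => t i | inr y => letter T y end.

Lemma glue_letter_l t T i : glue_letter t T (kappa i) = t i.
Proof.
rewrite /glue_letter -split_box_l -(permE split_box_inj) -/box_perm permK.
by rewrite (unsplitK (inl i)).
Qed.

Lemma glue_letter_r t T x : glue_letter t T (iota x) = letter T x.
Proof.
rewrite /glue_letter -split_box_r -(permE split_box_inj) -/box_perm permK.
by rewrite (unsplitK (inr x)).
Qed.

Lemma glue_card t T i : #|[pred x | glue_letter t T x == i]| = a.+1.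
Proof.
rewrite card_split; rewrite -[X in _ = X]add1n; congr (_ + _)%N.
  rewrite -(card1 (t^-1 i)%g); apply: eq_card => j; rewrite !inE /=.
  by rewrite glue_letter_l (canF_eq (permK t)).
rewrite -(letter_card T i); apply: eq_card => x; rewrite !inE /=.
by rewrite glue_letter_r.
Qed.

Definition glue t T : Om' := Filling (glue_card t T).

Lemma glueE t T x : letter (glue t T) x = glue_letter t T x.
Proof. exact: FillingE. Qed.

Lemma glue_inj t1 T1 t2 T2 : glue t1 T1 = glue t2 T2 -> t1 = t2 /\ T1 = T2.
Proof.
move=> eq_g; split.
  by apply/permP=> i; rewrite -(glue_letter_l t1 T1) -glueE eq_g glueE glue_letter_l.
by apply: filling_eq => x; rewrite -(glue_letter_r t1) -glueE eq_g glueE glue_letter_r.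
Qed.

Lemma glue_exists (T' : Om') : injective (fun i => letter T' (kappa i)) ->
  exists t T, T' = glue t T.
Proof.
move=> inj_k; exists (perm inj_k).
have card_i i : #|[pred x | letter T' (iota x) == i]| = a.
  have := letter_card T' i; rewrite card_split.
  rewrite (_ : #|_| = 1%N) ?add1n => [[]//|].
  rewrite -(card1 ((perm inj_k)^-1 i)%g); apply: eq_card => j; rewrite !inE /=.
  by rewrite -(canF_eq (permK (perm inj_k))) permE.
exists (Filling card_i); apply: filling_eq => x'; rewrite glueE.
have [[i ->] | [x ->]] := split_cover x'.
  by rewrite glue_letter_l permE.
by rewrite glue_letter_r FillingE.
Qed.

(* Deletes the added column of a filling, with the sign of the permutation    *)
(* that this column spells, or gives 0 if the column has a repeated letter.   *)
Definition del_col : 'M[F]_(#|Om'|, #|Om|) :=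
  \matrix_(k, l) \sum_(t : 'S_b)
    (if enum_val k == glue t (enum_val l) then sgn F true t else 0).

Lemma del_col_glue t T :
  basis_vec F (glue t T) *m del_col = sgn F true t *: basis_vec F T.
Proof.
rewrite -rowE; apply/rowP=> k; rewrite !mxE -[k]enum_valK.
move: (enum_val k) => S; rewrite enum_rankK !enum_rankK (inj_eq enum_rank_inj).
rewrite (bigD1 t) //= [X in _ + X]big1 ?addr0 => [|s ne_s].
  case: (S =P T) => [->|ne_S]; first by rewrite eqxx mulr1.
  by case: eqP => [/glue_inj[_ /esym//]|]; rewrite mulr0.
case: eqP => // /glue_inj[eq_t _]; by rewrite eq_t eqxx in ne_s.
Qed.

Lemma del_col_not_glue T' : (forall t T, T' <> glue t T) ->
  basis_vec F T' *m del_col = 0.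
Proof.
move=> notT; rewrite -rowE; apply/rowP=> k; rewrite !mxE enum_rankK big1 // => t _.
by case: eqP => // /notT.
Qed.

Lemma glueP T' : (exists t T, T' = glue t T) \/ (forall t T, T' <> glue t T).
Proof.
have [| no] := pselect (exists t T, T' = glue t T); first by left.
by right=> t T eqT; apply: no; exists t, T.
Qed.

Lemma relabel_glue t T s : relabel (glue t T) s = glue (t * s)%g (relabel T s).
Proof.
apply: filling_eq => x'; rewrite relabelE !glueE.
have [[i ->] | [x ->]] := split_cover x'.
  by rewrite !glue_letter_l permM.
by rewrite !glue_letter_r relabelE.
Qed.

Lemma del_col_hom s : L' s *m del_col = sgn F true s *: (del_col *m L s).
Proof.
apply: basis_vecP => T'; rewrite mulmxA basis_vec_act /= -scalemxAr mulmxA.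
have [[t [T ->]] | notT] := glueP T'.
  rewrite relabel_glue !del_col_glue -scalemxAl basis_vec_act scalerA /=.
  by rewrite sgnM mulrC.
rewrite (del_col_not_glue notT) mul0mx scaler0 del_col_not_glue // => t T eqT.
apply: (notT (t * s^-1)%g (relabel T s^-1)).
by rewrite -relabel_glue -eqT -relabelM mulgV relabel1.
Qed.

Lemma del_col_full : row_full del_col.
Proof.
rewrite -sub1mx; apply/row_subP=> k; rewrite rowE mulmx1 -[k]enum_valK.
move: (enum_val k) => T; have := del_col_glue 1%g T.
by rewrite /sgn odd_perm1 scale1r -/(basis_vec F T) => <-; apply: submxMl.
Qed.

Lemma theta_del_col (v : 'rV[F]_#|Om'|) :
  theta ri' (v *m fsum N' true cl')
    = \det (var_mx F b) * theta ri (v *m del_col *m fsum N true cl).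
Proof.
rewrite [v]row_basis !mulmx_suml !raddf_sum mulr_sumr /=.
apply: eq_bigr => T' _; rewrite -!scalemxAl !linearZ /= -scalerAr; congr (_ *: _).
rewrite theta_calt; have [[t [T ->]] | notT] := glueP T'.
  rewrite del_col_glue -scalemxAl linearZ /= theta_calt -scalerAr.
  rewrite (det_tableau_split (T := T)) => [|x]; last by rewrite glueE glue_letter_r.
  rewrite [RHS]scalerAl; apply: (congr1 (fun z => z * _)).
  rewrite (_ : \matrix_(i, j) _ = col_perm t (var_mx F b)); last first.
    by apply/matrixP=> i j; rewrite !mxE glueE glue_letter_l.
  rewrite col_permE det_mulmx det_perm odd_permV mulrC.
  by rewrite /sgn /= scaler_sign mulr_sign.
rewrite del_col_not_glue // mul0mx raddf0 mulr0.
have /injectivePn[i [j ne_ij eq_ij]] :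
    ~~ injectiveb (fun i => letter T' (kappa i)).
  by apply/negP => /injectiveP/glue_exists[t [T /notT]].
rewrite -(det_reindex box_perm); set M := \matrix_(_, _) _.
rewrite -det_tr; apply: (determinant_alternate (i1 := lshift n i) (i2 := lshift n j)).
  by rewrite eq_lshift.
move=> x; rewrite !mxE !permE !split_box_l eq_ij.
by have [_ ->] := kappaP i; have [_ ->] := kappaP j.
Qed.

Lemma rank_del_col e1 f1 e2 f2 :
  \rank (fsum L' e1 f1 *m fsum L' e2 f2
    *m (fsum N' true cl' *m fsum N' false (fun x => ri' x : nat)))
  = \rank (fsum L (~~ e1) f1 *m fsum L (~~ e2) f2
    *m (fsum N true cl *m fsum N false (fun x => ri x : nat))).
Proof.
have homJ e f : fsum L' e f *m del_col = del_col *m fsum L (~~ e) f.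
  by rewrite -addbT; apply: fsum_hom del_col_hom.
have homP : fsum L' e1 f1 *m fsum L' e2 f2 *m del_col
    = del_col *m (fsum L (~~ e1) f1 *m fsum L (~~ e2) f2).
  by rewrite -mulmxA homJ !mulmxA homJ.
rewrite -[RHS](eqmxMfull _ del_col_full); apply: eq_rank_ker => v.
move: (fsum L' e1 f1 *m fsum L' e2 f2) (fsum L _ f1 *m fsum L _ f2) homP.
move=> P' P homP; rewrite !mulmxA.
have thE : theta ri' (v *m P' *m fsum N' true cl')
    = \det (var_mx F b) * theta ri (v *m del_col *m P *m fsum N true cl).
  by rewrite theta_del_col -[v *m P' *m _]mulmxA homP mulmxA.
split=> /theta_eq0 th0; apply/theta_eq0.
  by move/eqP: th0; rewrite thE mulf_eq0 (negPf (det_var_neq0 F b)) => /eqP.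
by rewrite thE th0 mulr0.
Qed.

End ExtraColumn.

(** * The multiplicity formula *)

Lemma calt_tall (F : numFieldType) n b a (cl : 'I_n -> nat) (c : 'I_b.+1 -> 'I_n) :
    injective c -> (forall i j, cl (c i) = cl (c j)) ->
  fsum (place_module n b a F) true cl = 0.
Proof.
move=> inj_c eq_cl; apply: basis_vecP => T; rewrite mulmx0.
have /injectivePn[i [j ne_ij eq_ij]] : ~~ injectiveb (fun i => letter T (c i)).
  by apply/negP => /injectiveP/leq_card; rewrite !card_ord ltnn.
pose t := tperm (c i) (c j).
have Ct : t \in fiber_stab cl.
  by apply/fiber_stabP=> x; rewrite /t; case: tpermP => [->|->|].
have fixT : place T t = T.
  by apply: filling_eq => x; rewrite placeE tpermV /t; case: tpermP => [->|->|].
have := congr1 (mulmx (basis_vec F T)) (fsumMl (place_module n b a F) true Ct).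
rewrite mulmxA basis_vec_act /= fixT /sgn odd_tperm (inj_eq inj_c) ne_ij.
rewrite scaleN1r mulmxN => /eqP.
by rewrite -addr_eq0 -mulr2n -scaler_nat scaler_eq0 pnatr_eq0 => /eqP.
Qed.

Lemma rank_swap_leq (F : fieldType) n (A B Y : 'M[F]_n) (l : F) :
    l != 0 -> A *m B *m (A *m B) = l *: (A *m B) -> B *m Y = Y *m B ->
  (\rank (A *m B *m Y) <= \rank (B *m A *m Y))%N.
Proof.
move=> nz_l ABAB BY; rewrite -(eqmx_scale (A *m B *m Y) nz_l).
have -> : l *: (A *m B *m Y) = A *m (B *m A *m Y *m B).
  by rewrite scalemxAl -ABAB -!mulmxA BY.
exact: leq_trans (mxrankM_maxr _ _) (mxrankM_maxl _ _).
Qed.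

Section Multiplicity.

Variables (F : numClosedFieldType) (b : nat).

Lemma rank_row_col_swap a n (nu : seq nat) (Y : 'M[F]_#|{: filling n b a}|) :
    let L := relabel_module n b a F in
    diagram (@box_row b nu) (@box_col b nu) ->
    (forall e f, fsum L e f *m Y = Y *m fsum L e f) ->
  \rank (fsum L false (@box_row b nu) *m fsum L true (@box_col b nu) *m Y)
    = \rank (fsum L true (@box_col b nu) *m fsum L false (@box_row b nu) *m Y).
Proof.
move=> L D comm; have [l nz_l lP] := young_quasi_idem F D.
have idem := lP _ L.
apply/eqP; rewrite eqn_leq !(rank_swap_leq nz_l) //.
have := congr1 trmx idem; rewrite linearZ /= !trmx_mul !fsum_tr.
by move=> ->.
Qed.

Lemma multiplicity_foulkes a (nu mu : seq nat) : (0 < a)%N ->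
    diagram (@box_row b nu) (@box_col b nu) ->
    diagram (@box_row (a * b) mu) (@box_col (a * b) mu) ->
  let L := relabel_module (a * b) b a F in
  let N := place_module (a * b) b a F in
  multiplicity (specht F (a * b) mu) (foulkes a b F nu) =
  \rank (fsum L false (@box_row b nu) *m fsum L true (@box_col b nu) *m
         (fsum N true (@box_col _ mu) *m fsum N false (@box_row _ mu))).
Proof.
move=> a_gt0 Dnu Dmu L N; rewrite multiplicity_specht // rank_foulkes //.
rewrite -mxrank_tr !trmx_mul !fsum_tr; congr (\rank _).
have comm e f : fsum N e f *m (fsum L false (@box_row b nu)
      *m fsum L true (@box_col b nu))
    = fsum L false (@box_row b nu) *m fsum L true (@box_col b nu) *m fsum N e f.
  by rewrite mulmxA place_relabel_comm -mulmxA place_relabel_comm mulmxA.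
by rewrite -[LHS]mulmxA comm [LHS]mulmxA comm -[LHS]mulmxA.
Qed.

Lemma multiplicity_tall a (nu mu : seq nat) : (0 < a)%N ->
    diagram (@box_row b nu) (@box_col b nu) ->
    diagram (@box_row (a * b) mu) (@box_col (a * b) mu) ->
    (forall i, (i <= b)%N ->
      exists x : 'I_(a * b), box_row mu x = i /\ box_col mu x = 0%N) ->
  multiplicity (specht F (a * b) mu) (foulkes a b F nu) = 0%N.
Proof.
move=> a_gt0 Dnu Dmu tall; rewrite multiplicity_foulkes //.
have /fin_all_exists[c cP] (i : 'I_b.+1) : exists x : 'I_(a * b),
    box_row mu x = i /\ box_col mu x = 0%N by apply: tall; rewrite -ltnS.
rewrite (@calt_tall F _ b a (@box_col _ mu) c) ?mul0mx ?mulmx0 ?mxrank0 //.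
  move=> i j eq_c; apply: val_inj; have [ri _] := cP i; have [rj _] := cP j.
  by rewrite /= -ri -rj eq_c.
by move=> i j; have [_ ->] := cP i; have [_ ->] := cP j.
Qed.

Theorem multiplicity_add_column a (nu mu : seq nat) :
    (0 < a)%N -> is_partn b nu -> is_partn (a * b) mu ->
  multiplicity (specht F (a.+1 * b) (add_partn mu (nseq b 1%N)))
               (foulkes a.+1 b F (conj_partn nu)) =
  multiplicity (specht F (a * b) mu) (foulkes a b F nu).
Proof.
move=> a_gt0 nuP muP; set mu' := add_partn _ _; set nu' := conj_partn nu.
have [z zP] := conj_partn_boxes nuP.
have [_ _ /eqP sum_nu] := and3P nuP; have [_ _ /eqP sum_mu] := and3P muP.
have Dnu : diagram (@box_row b nu) (@box_col b nu).
  by apply: box_diagram => // i j; apply: (partn_nth_geq nuP).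
have Dmu : diagram (@box_row (a * b) mu) (@box_col (a * b) mu).
  by apply: box_diagram => // i j; apply: (partn_nth_geq muP).
have rnu' : @box_row b nu' = @box_col b nu \o z.
  by apply: funext => x; have [-> _] := zP x.
have cnu' : @box_col b nu' = @box_row b nu \o z.
  by apply: funext => x; have [_ ->] := zP x.
have Dnu' : diagram (@box_row b nu') (@box_col b nu').
  by rewrite rnu' cnu'; apply/diagram_perm/diagram_sym.
have Dmu' : diagram (@box_row (a.+1 * b) mu') (@box_col (a.+1 * b) mu').
  exact: add_col_diagram muP.
have [tall | le_mu] := ltnP b (size mu).
  rewrite !multiplicity_tall // => i le_i.
    by apply: (partn_col0 muP); apply: leq_ltn_trans tall.
  apply: (add_col_col0 muP); rewrite leq_max; apply/orP; right.
  exact: leq_ltn_trans tall.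
have lt_r (x : 'I_(a * b)) : (box_row mu x < b)%N.
  by apply: leq_trans le_mu; apply: reshape_indexP; rewrite sum_mu.
have lt_r' (x : 'I_(b + a * b)) : (box_row mu' x < b)%N.
  have := box_bound (sumn_add_col b muP) x; rewrite (nth_add_col b mu).
  case: (ltnP (box_row mu' x) b) => // le_b; rewrite nth_default ?ltn0 //.
  exact: leq_trans le_b.
pose ri x := Ordinal (lt_r x); pose ri' x := Ordinal (lt_r' x).
have /fin_all_exists[kappa kappaP] (i : 'I_b) : exists x : 'I_(b + a * b),
    ri' x = i /\ box_col mu' x = 0%N.
  have lt_i : (i < maxn b (size mu))%N by rewrite leq_max ltn_ord.
  have [x [rx cx]] := add_col_col0 muP lt_i.
  by exists x; split=> //; apply: val_inj.
have /fin_all_exists[iota iotaP] (x : 'I_(a * b)) : exists y : 'I_(b + a * b),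
    ri' y = ri x /\ box_col mu' y = (box_col mu x).+1.
  have [y [ry cy]] := add_col_shift muP (lt_r x).
  by exists y; split=> //; apply: val_inj.
have inj_d : injective (fun x => (ri x, box_col mu x)).
  by move=> x y [eq_r eq_c]; apply: (box_inj (mu := mu)); rewrite eq_r eq_c.
rewrite !multiplicity_foulkes //.
rewrite (rank_del_col F a inj_d kappaP iotaP false (box_row nu') true (box_col nu')) /=.
rewrite -[fun x => ri x : nat]/(@box_row (a * b) mu).
set L := relabel_module _ _ _ _; set N := place_module _ _ _ _.
set Y := fsum N _ _ *m fsum N _ _.
have commY e f : fsum L e f *m Y = Y *m fsum L e f.
  by rewrite mulmxA -place_relabel_comm -mulmxA -place_relabel_comm mulmxA.
have commYz : Y *m L z^-1%g = L z^-1%g *m Y.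
  by rewrite -[LHS]mulmxA fsum_place_relabel mulmxA fsum_place_relabel mulmxA.
rewrite rank_row_col_swap // rnu' cnu' -{1 2}[z]invgK -!fsumJ invgK.
have fullz g : row_full (L g) by rewrite row_full_unit repr_mx_unit ?inE.
have freez g : row_free (L g) by rewrite row_free_unit repr_mx_unit ?inE.
have Lzz : L z^-1%g *m L z = 1%:M by rewrite -reprM mulVg repr_mx1.
rewrite -!mulmxA (eqmxMfull _ (fullz _)) [L z^-1%g *m (L z *m _)]mulmxA Lzz mul1mx.
by rewrite -commYz !mulmxA mxrankMfree.
Qed.

End Multiplicity.

Theorem corollary13 (R : realType) (a b : nat) (nu mu : seq nat)
    (ha : (2 <= a)%N) (hb : (2 <= b)%N)
    (hnu : is_partn b nu) (hmu : is_partn (a * b) mu) :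
  let mu' := add_partn mu (nseq b 1%N) in
  multiplicity (specht (complex R) (a.+1 * b) mu')
               (foulkes a.+1 b (complex R) (conj_partn nu)) =
  multiplicity (specht (complex R) (a * b) mu)
               (foulkes a b (complex R) nu).
Proof. by apply: multiplicity_add_column => //; apply: ltnW. Qed.
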